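(* There exists a constant $L\ge 0$ such that the following holds. Let $f$ be a holomorphic function on the unit disc $\Delta=\{z\in\mathbb{C}:|z|<1\}$ whose range omits $0$ and $1$, and suppose $|f(0)|<M$. Then for every $r\in(0,1)$, $$|f(z)|<\tan\left(\arctan M+\frac{2rL}{1-r^2}\right)\quad\text{for all } z \text{ with } |z|<r.$$
   Context: The constant $L$ is absolute: it does not depend on $f$, $M$, $r$ or $z$.
   Formalization: The bound is claimed only while arctan M + 2rL/(1-r^2) < π/2; without this it fails for every L ≥ 0 (f = 2, M = 3, r with the angle equal to π, if L > 0; f(z) = z+5, M = 5.1, r = 0.9, z = 0.5, if L = 0). *)

(* Defs.v *)
From Stdlib Require Import Reals.
From Coquelicot Require Import Coquelicot.

Open Scope R_scope.

Definition unit_disc (z : C) : Prop := Cmod z < 1.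

(* Meant for an open set D: complex differentiability at z depends only on f near z,
   so values of f outside D play no role. *)
Definition holomorphic_on (D : C -> Prop) (f : C -> C) : Prop :=
  forall z : C, D z -> ex_derive (K := C_AbsRing) (V := C_NormedModule) f z.

Definition omits_on (D : C -> Prop) (f : C -> C) (w : C) : Prop :=
  forall z : C, D z -> f z <> w.

(* Main.v *)
Require Import Defs.
From Stdlib Require Import Reals ZArith Lra Lia Psatz ClassicalEpsilon.
From Coquelicot Require Import Coquelicot.
Open Scope R_scope.

(** The theorem integrates a pointwise estimate of Landau type: if [f] is
    holomorphic on the disc of centre [a] and radius [r] and omits [0] and [1],
    then [|f'(a)| r <= L (1 + |f(a)|^2)] with [L] absolute ([landau_ball]).  For
    [|z| < r] it applies at each point of the segment from [0] to [z], with
    radius [1 - r], and bounds the derivative of [t |-> atan |f(t z)|] by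
    [L r / (1 - r) <= 2 r L / (1 - r^2)].  The mean value theorem bounds the
    increase of [atan |f|] along the segment, and [tan] is increasing below
    [PI/2].

    Landau's estimate is proved by the method of Bloch, Landau and Estermann.
    Write [- f = exp (i PI p)]; then [p] omits the odd integers, because [f]
    omits [1].  In particular [p] omits [1] and [-1], so [p^2 - 1] has a square
    root [s], the function [p + s] has inverse [p - s] and hence a logarithm [G],
    and [p = cosh G] ([cosh_lift]).  The values [G] cannot take, the points where
    [cosh] is an odd integer, come within distance [11] of every point of the
    plane ([cosh_odd_net]), so the range of [G] contains no disc of radius [11].
    Bloch's theorem ([bloch]) then bounds [|G'(0)|], and the chain rule turns this
    into [|f'(0)| <= const |f(0)| (|ln |f(0)|| + 2 PI)].

    Bloch's theorem combines a choice of centre, at which [|f'|] is at least half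
    of its supremum over a suitable disc around it ([point_selection]), with
    Newton's iteration, which converges there to a solution of [f z = w] for
    every [w] in a disc ([newton_covering]).

    Differentiability is assumed pointwise, so the regularity of [f'] has to be
    established.  Goursat's theorem for triangles ([goursat]) is applied in the
    coordinate [z = a + exp zeta]: the function
    [(f (a + exp zeta) - f a) exp (- zeta)] is holomorphic on a half plane, which
    is convex, and periodic, so its integral over one vertical period does not
    depend on the abscissa; letting the abscissa go to minus infinity shows that
    [f'(a)] is the average of the difference quotients of [f] over any circle
    around [a] whose disc lies in the domain ([derivative_circle]).  Cauchy's estimate, the Lipschitz continuity
    of [f'] and finally its differentiability ([derivative_differentiable_at])
    are read off from this formula. *)

(** * Complex derivatives *)

(** The field [C] serves here as a normed module over itself through its absolute value, the
    structure in which the library's product and chain rules apply; [C_NormedModule] has the same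
    norm and the product uniform structure. *)
Definition is_cderive (f : C -> C) (z l : C) : Prop :=
  is_derive (K := C_AbsRing) (V := AbsRing_NormedModule C_AbsRing) f z l.

Lemma is_cderive_eps (f : C -> C) (z l : C) :
  is_cderive f z l <->
  forall eps : R, 0 < eps -> exists delta : R, 0 < delta /\
    forall w : C, Cmod (w - z) < delta ->
      Cmod (f w - f z - l * (w - z)) <= eps * Cmod (w - z).
Proof.
split.
- intros [_ H] eps Heps.
  destruct (H z (fun P HP => HP) (mkposreal eps Heps)) as [d Hd].
  exists d; split; [apply cond_pos|].
  intros w Hw. specialize (Hd w Hw).
  replace (f w - f z - l * (w - z))%C with (f w - f z - (w - z) * l)%C by ring.
  exact Hd.
- intros H; split.
  + apply (is_linear_scal_l (K := C_AbsRing) (V := AbsRing_NormedModule C_AbsRing) l).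
  + intros x Hx eps.
    assert (x = z) as ->.
    { symmetry. apply (is_filter_lim_locally_unique (K:=C_AbsRing) (V := AbsRing_NormedModule C_AbsRing) z x Hx). }
    destruct (H eps (cond_pos eps)) as [d [Hd Hw]].
    exists (mkposreal d Hd). intros w Hw'. specialize (Hw w Hw').
    replace (f w - f z - l * (w - z))%C with (f w - f z - (w - z) * l)%C in Hw by ring.
    exact Hw.
Qed.

Lemma is_cderive_of_is_derive (f : C -> C) (z l : C) :
  is_derive (K := C_AbsRing) (V := C_NormedModule) f z l -> is_cderive f z l.
Proof.
intros [_ H]; split; [|exact H].
apply (is_linear_scal_l (K := C_AbsRing) (V := AbsRing_NormedModule C_AbsRing) l).
Qed.

Lemma is_cderive_const (c z : C) : is_cderive (fun _ => c) z (RtoC 0).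
Proof. exact (is_derive_const (K:=C_AbsRing) (V := AbsRing_NormedModule C_AbsRing) c z). Qed.

Lemma is_cderive_id (z : C) : is_cderive (fun x => x) z (RtoC 1).
Proof. exact (is_derive_id (K:=C_AbsRing) z). Qed.

Lemma is_cderive_plus (f g : C -> C) (z a b : C) :
  is_cderive f z a -> is_cderive g z b -> is_cderive (fun x => f x + g x)%C z (a + b)%C.
Proof. exact (is_derive_plus (K:=C_AbsRing) (V := AbsRing_NormedModule C_AbsRing) f g z a b). Qed.

Lemma is_cderive_mult (f g : C -> C) (z a b : C) :
  is_cderive f z a -> is_cderive g z b ->
  is_cderive (fun x => f x * g x)%C z (a * g z + f z * b)%C.
Proof. intros Hf Hg. exact (is_derive_mult (K:=C_AbsRing) f g z a b Hf Hg Cmult_comm). Qed.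

Lemma is_cderive_comp (f g : C -> C) (z a b : C) :
  is_cderive f (g z) a -> is_cderive g z b -> is_cderive (fun x => f (g x)) z (a * b)%C.
Proof.
intros Hf Hg. rewrite Cmult_comm.
exact (is_derive_comp (K:=C_AbsRing) (V := AbsRing_NormedModule C_AbsRing) f g z a b Hf Hg).
Qed.

Lemma is_cderive_ext (f g : C -> C) (z a b : C) :
  (forall x, f x = g x) -> a = b -> is_cderive f z a -> is_cderive g z b.
Proof.
intros E <-.
exact (is_derive_ext (K:=C_AbsRing) (V := AbsRing_NormedModule C_AbsRing) f g z a E).
Qed.

Lemma is_cderive_scal (c : C) (f : C -> C) (z l : C) :
  is_cderive f z l -> is_cderive (fun w => c * f w)%C z (c * l)%C.
Proof.
intros H. eapply is_cderive_ext; [reflexivity| |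
  apply (is_cderive_mult (fun _ => c) f); [apply is_cderive_const|exact H]]. ring.
Qed.

Lemma is_cderive_minus (f g : C -> C) (z a b : C) :
  is_cderive f z a -> is_cderive g z b -> is_cderive (fun x => f x - g x)%C z (a - b)%C.
Proof.
intros Hf Hg. eapply is_cderive_ext; [| |apply (is_cderive_plus f _ z a _ Hf (is_cderive_scal (- (1)) g z b Hg))].
- intros x; cbv beta; ring.
- ring.
Qed.

Definition Ccont (f : C -> C) (z : C) : Prop :=
  forall eps : R, 0 < eps -> exists delta : R, 0 < delta /\
    forall w : C, Cmod (w - z) < delta -> Cmod (f w - f z) < eps.

Lemma Ccont_derive (f : C -> C) (z l : C) : is_cderive f z l -> Ccont f z.
Proof.
intros H eps Heps. rewrite is_cderive_eps in H.
destruct (H 1 Rlt_0_1) as [d [Hd Hw]].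
pose proof (Cmod_ge_0 l) as Hl.
exists (Rmin d (eps / (2 + Cmod l))); split.
- apply Rmin_pos; [easy|]. apply Rdiv_lt_0_compat; lra.
- intros w Hwz.
  assert (H1 := Rlt_le_trans _ _ _ Hwz (Rmin_l _ _)).
  assert (H2 := Rlt_le_trans _ _ _ Hwz (Rmin_r _ _)).
  specialize (Hw w H1).
  replace (f w - f z)%C with ((f w - f z - l * (w - z)) + l * (w - z))%C by ring.
  eapply Rle_lt_trans; [apply Cmod_triangle|]. rewrite Cmod_mult.
  apply (Rmult_lt_compat_r (2 + Cmod l)) in H2; [|lra].
  replace (eps / (2 + Cmod l) * (2 + Cmod l)) with eps in H2 by (field; lra).
  pose proof (Cmod_ge_0 (w - z)). nra.
Qed.

Lemma is_cderive_inv (f : C -> C) (z a : C) :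
  is_cderive f z a -> f z <> 0 -> is_cderive (fun x => / f x)%C z (- a / (f z * f z))%C.
Proof.
intros Hf Hz.
assert (Hi : is_cderive Cinv (f z) (- / (f z * f z))%C).
{ clear Hf. set (u := f z) in *. apply is_cderive_eps; intros eps Heps.
  assert (Hu : 0 < Cmod u) by now apply Cmod_gt_0.
  exists (Rmin (Cmod u / 2) (eps * Cmod u ^ 3 / 2)); split.
  { apply Rmin_pos; [lra|]. assert (0 < Cmod u ^ 3) by now apply pow_lt. nra. }
  intros w Hw.
  assert (H1 := Rlt_le_trans _ _ _ Hw (Rmin_l _ _)).
  assert (H2 := Rlt_le_trans _ _ _ Hw (Rmin_r _ _)).
  assert (Hw2 : Cmod u / 2 < Cmod w).
  { pose proof (Cmod_triangle w (- (w - u))) as T.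
    replace (w + - (w - u))%C with u in T by ring. rewrite Cmod_opp in T. lra. }
  assert (Hw0 : w <> 0) by (apply Cmod_gt_0; lra).
  replace (/ w - / u - - / (u * u) * (w - u))%C
    with ((w - u) * ((w - u) / (u * u * w)))%C by now (field; split).
  rewrite Cmod_mult, Rmult_comm.
  apply Rmult_le_compat_r; [apply Cmod_ge_0|].
  rewrite Cmod_div by (repeat apply Cmult_neq_0; easy).
  rewrite !Cmod_mult.
  assert (0 < Cmod u * Cmod u * Cmod w) by (repeat apply Rmult_lt_0_compat; lra).
  apply Rle_div_l; [easy|].
  apply Rlt_le, (Rlt_le_trans _ _ _ H2).
  replace (eps * Cmod u ^ 3 / 2) with (eps * (Cmod u * Cmod u * (Cmod u / 2))) by field.
  apply Rmult_le_compat_l; [lra|]. apply Rmult_le_compat_l; [|lra].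
  apply Rmult_le_pos; lra. }
eapply is_cderive_ext; [intros; reflexivity| |exact (is_cderive_comp Cinv f z _ _ Hi Hf)].
now field.
Qed.

Lemma is_cderive_affine (p q l z : C) : is_cderive (fun w => p + q * (w - l))%C z q.
Proof.
eapply is_cderive_ext with (a := (0 + (0 * (z - l) + q * (1 + 0)))%C); [reflexivity|ring|].
apply (is_cderive_plus (fun _ => p)); [apply is_cderive_const|].
apply (is_cderive_mult (fun _ => q) (fun w => w - l)%C); [apply is_cderive_const|].
apply (is_cderive_plus (fun w => w) (fun _ => - l)%C); [apply is_cderive_id|apply is_cderive_const].
Qed.

(** * The complex exponential *)

Definition Cexp (z : C) : C := (exp (fst z) * cos (snd z), exp (fst z) * sin (snd z)).

Lemma Cexp_plus (z w : C) : Cexp (z + w) = (Cexp z * Cexp w)%C.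
Proof.
unfold Cexp, Cplus, Cmult; simpl. rewrite exp_plus, cos_plus, sin_plus.
f_equal; ring.
Qed.

Lemma Cexp_0 : Cexp 0 = 1.
Proof. unfold Cexp; simpl. rewrite exp_0, cos_0, sin_0. unfold RtoC; f_equal; ring. Qed.

Lemma Cexp_opp_mult (z : C) : (Cexp z * Cexp (- z))%C = 1.
Proof. rewrite <- Cexp_plus, <- Cexp_0. f_equal. ring. Qed.

Lemma Cmod_Cexp (z : C) : Cmod (Cexp z) = exp (fst z).
Proof.
unfold Cmod, Cexp; simpl.
pose proof (sin2_cos2 (snd z)) as T; unfold Rsqr in T.
replace (_ + _) with (exp (fst z) * exp (fst z)
  * (sin (snd z) * sin (snd z) + cos (snd z) * cos (snd z))) by ring.
rewrite T, Rmult_1_r. apply sqrt_square, Rlt_le, exp_pos.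
Qed.

Lemma Cmod_le_abs (z : C) : Cmod z <= Rabs (fst z) + Rabs (snd z).
Proof.
unfold Cmod. pose proof (Rabs_pos (fst z)). pose proof (Rabs_pos (snd z)).
rewrite <- (sqrt_pow2 (Rabs (fst z) + Rabs (snd z))) by lra.
apply sqrt_le_1_alt. rewrite <- (pow2_abs (fst z)), <- (pow2_abs (snd z)). nra.
Qed.

Lemma fst_le_Cmod (z : C) : Rabs (fst z) <= Cmod z.
Proof. eapply Rle_trans; [apply Rmax_l|apply Rmax_Cmod]. Qed.

Lemma snd_le_Cmod (z : C) : Rabs (snd z) <= Cmod z.
Proof. eapply Rle_trans; [apply Rmax_r|apply Rmax_Cmod]. Qed.

Lemma is_derive_eps {V : NormedModule R_AbsRing} (f : R -> V) (x : R) (l : V) :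
  is_derive f x l <->
  forall eps : R, 0 < eps -> exists delta : R, 0 < delta /\
    forall y : R, Rabs (y - x) < delta ->
      norm (minus (minus (f y) (f x)) (scal (y - x) l)) <= eps * Rabs (y - x).
Proof.
split.
- intros [_ H] eps Heps.
  destruct (H x (fun P HP => HP) (mkposreal eps Heps)) as [d Hd].
  exists d; split; [apply cond_pos|]. exact Hd.
- intros H; split; [apply is_linear_scal_l|].
  intros y Hy eps.
  assert (y = x) as ->
    by (symmetry; apply (is_filter_lim_locally_unique (V := R_NormedModule) x y Hy)).
  destruct (H eps (cond_pos eps)) as [d [Hd Hw]].
  exists (mkposreal d Hd). exact Hw.
Qed.

Lemma is_derive_eps_real (f : R -> R) (x l : R) : is_derive f x l ->
  forall eps : R, 0 < eps -> exists delta : R, 0 < delta /\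
    forall y : R, Rabs (y - x) < delta ->
      Rabs (f y - f x - (y - x) * l) <= eps * Rabs (y - x).
Proof. intros H; apply (proj1 (is_derive_eps f x l) H). Qed.

(** The real part of [exp h - 1 - h] splits as [(e^x - 1 - x) + e^x (cos y - 1)] and the imaginary
    part as [(e^x - 1) sin y + (sin y - y)]; each term is small by the real derivatives at 0. *)
Lemma is_cderive_Cexp_0 : is_cderive Cexp 0 1.
Proof.
apply is_cderive_eps; intros eps Heps.
assert (He : 0 < eps / 5) by lra.
destruct (is_derive_eps_real exp 0 (exp 0) (is_derive_exp 0) _ He) as [d1 [Hd1 H1]].
destruct (is_derive_eps_real cos 0 (- sin 0) (is_derive_cos 0) _ He) as [d2 [Hd2 H2]].
destruct (is_derive_eps_real sin 0 (cos 0) (is_derive_sin 0) _ He) as [d3 [Hd3 H3]].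
set (e := eps / 5) in *. replace eps with (5 * e) by (unfold e; field).
exists (Rmin (Rmin d1 d2) (Rmin d3 (Rmin 1 e / (2 + e) ^ 2))); split.
{ repeat apply Rmin_pos; try lra. apply Rdiv_lt_0_compat; [apply Rmin_pos; lra|nra]. }
intros [x y] Hw. rewrite Cexp_0.
replace ((x, y) - 0)%C with ((x, y) : C) in * by (unfold Cminus, Cplus, RtoC; simpl; f_equal; ring).
pose proof (fst_le_Cmod (x, y)) as Hx. pose proof (snd_le_Cmod (x, y)) as Hy.
simpl in Hx, Hy.
assert (A1 := Rlt_le_trans _ _ _ Hw (Rmin_l _ _)).
assert (A2 := Rlt_le_trans _ _ _ Hw (Rmin_r _ _)).
assert (B1 := Rlt_le_trans _ _ _ A1 (Rmin_l _ _)).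
assert (B2 := Rlt_le_trans _ _ _ A1 (Rmin_r _ _)).
assert (B3 := Rlt_le_trans _ _ _ A2 (Rmin_l _ _)).
assert (B4 := Rlt_le_trans _ _ _ A2 (Rmin_r _ _)). clear A1 A2 Hw.
rewrite exp_0, ?cos_0, ?sin_0 in *.
specialize (H1 x ltac:(rewrite Rminus_0_r; lra)).
specialize (H2 y ltac:(rewrite Rminus_0_r; lra)).
specialize (H3 y ltac:(rewrite Rminus_0_r; lra)).
rewrite !Rminus_0_r in *. rewrite Rmult_1_r in H1, H3.
replace (cos y - 1 - y * - 0) with (cos y - 1) in H2 by ring.
apply Rlt_div_r in B4; [|nra].
pose proof (Rmin_l 1 e). pose proof (Rmin_r 1 e).
set (c := Cmod (x, y)) in *.
assert (Hc : 0 <= c) by apply Cmod_ge_0.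
assert (Hsin : Rabs (sin y) <= (1 + e) * c).
{ replace (sin y) with ((sin y - y) + y) by ring.
  eapply Rle_trans; [apply Rabs_triang|]. nra. }
assert (Hexp : Rabs (exp x - 1) <= (1 + e) * c).
{ replace (exp x - 1) with ((exp x - 1 - x) + x) by ring.
  eapply Rle_trans; [apply Rabs_triang|]. nra. }
assert (Hexp2 : Rabs (exp x) <= 2).
{ replace (exp x) with ((exp x - 1) + 1) by ring.
  eapply Rle_trans; [apply Rabs_triang|]. rewrite Rabs_R1. nra. }
eapply Rle_trans; [apply Cmod_le_abs|].
unfold Cexp, Cminus, Cplus, Copp, Cmult, RtoC; simpl.
replace (exp x * cos y + - (1) + - (1 * x - 0 * y))
  with ((exp x - 1 - x) + exp x * (cos y - 1)) by ring.
replace (exp x * sin y + - 0 + - (1 * y + 0 * x))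
  with ((exp x - 1) * sin y + (sin y - y)) by ring.
assert (T1 := Rabs_triang (exp x - 1 - x) (exp x * (cos y - 1))).
assert (T2 := Rabs_triang ((exp x - 1) * sin y) (sin y - y)).
rewrite Rabs_mult in T1, T2.
assert (Rabs (exp x) * Rabs (cos y - 1) <= 2 * (e * c)).
{ apply Rmult_le_compat; try apply Rabs_pos; nra. }
assert (Rabs (exp x - 1) * Rabs (sin y) <= e * c).
{ apply Rle_trans with (((1 + e) * c) * ((1 + e) * c)).
  - apply Rmult_le_compat; try apply Rabs_pos; easy.
  - replace ((1 + e) * c * ((1 + e) * c)) with ((c * (1 + e) ^ 2) * c) by ring.
    apply Rmult_le_compat_r; nra. }
nra.
Qed.

Lemma is_cderive_Cexp (z : C) : is_cderive Cexp z (Cexp z).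
Proof.
assert (H : is_cderive (fun x => Cexp z * Cexp (x + - z))%C z
   (0 * Cexp (z + - z) + Cexp z * (1 * (1 + 0)))%C).
{ apply (is_cderive_mult (fun _ => Cexp z) (fun x => Cexp (x + - z))%C z 0 (1 * (1 + 0))%C); [apply is_cderive_const|].
  apply (is_cderive_comp Cexp (fun x => x + - z)%C z 1 (1 + 0)%C).
  - cbv beta; rewrite Cplus_opp_r. exact is_cderive_Cexp_0.
  - apply (is_cderive_plus (fun x => x) (fun _ => - z)%C); [apply is_cderive_id|apply is_cderive_const]. }
revert H. apply is_cderive_ext; [|ring].
intros x. rewrite <- Cexp_plus. f_equal. ring.
Qed.

Lemma is_cderive_Cexp_opp (z : C) : is_cderive (fun w => Cexp (- w)) z (- Cexp (- z))%C.
Proof.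
eapply is_cderive_ext with (f := fun w => Cexp (- (1) * w)%C); [| |
  apply (is_cderive_comp Cexp (fun w => - (1) * w)%C); [apply is_cderive_Cexp|];
  apply (is_cderive_scal (- (1)) (fun w => w)), is_cderive_id].
- intros w. f_equal. ring.
- cbv beta. replace (- (1) * z)%C with (- z)%C by ring. ring.
Qed.

(** * Segments and the mean value inequality *)

Definition seg (a b : C) (t : R) : C := (a + t * (b - a))%C.

Lemma seg_0 (a b : C) : seg a b 0 = a.
Proof. unfold seg; ring. Qed.

Lemma seg_1 (a b : C) : seg a b 1 = b.
Proof. unfold seg; ring. Qed.

Lemma Cmod_seg (a b : C) (t : R) : 0 <= t <= 1 -> Cmod (seg a b t - a) <= Cmod (b - a).
Proof.
intros Ht. replace (seg a b t - a)%C with (RtoC t * (b - a))%C by (unfold seg; ring).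
rewrite Cmod_mult, Cmod_R, Rabs_right by lra. pose proof (Cmod_ge_0 (b - a)). nra.
Qed.

Lemma norm_C_R (z : C) : norm (V := C_R_NormedModule) z = Cmod z.
Proof.
unfold norm; simpl. unfold prod_norm, Cmod. f_equal.
unfold norm; simpl; unfold abs; simpl. now rewrite !Rmult_1_r, <- !Rabs_mult, !Rabs_right by (apply Rle_ge, Rle_0_sqr).
Qed.

Lemma is_derive_seg (f : C -> C) (a b : C) (t : R) (l : C) :
  is_cderive f (seg a b t) l ->
  is_derive (V := C_R_NormedModule) (fun s => f (seg a b s)) t (l * (b - a))%C.
Proof.
intros H. apply is_derive_eps; intros eps Heps.
pose proof (Cmod_ge_0 (b - a)) as Hba.
assert (He : 0 < eps / (1 + Cmod (b - a))) by (apply Rdiv_lt_0_compat; lra).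
destruct (proj1 (is_cderive_eps _ _ _) H _ He) as [d [Hd Hw]].
exists (d / (1 + Cmod (b - a))); split; [apply Rdiv_lt_0_compat; lra|].
intros y Hy.
assert (E : (seg a b y - seg a b t)%C = (RtoC (y - t) * (b - a))%C)
  by (unfold seg; rewrite RtoC_minus; ring).
specialize (Hw (seg a b y)). rewrite E, Cmod_mult, Cmod_R in Hw.
pose proof (Rabs_pos (y - t)) as Hyt.
assert (Hlt : Rabs (y - t) * Cmod (b - a) < d).
{ apply (Rmult_lt_compat_r (1 + Cmod (b - a))) in Hy; [|lra].
  replace (d / (1 + Cmod (b - a)) * (1 + Cmod (b - a))) with d in Hy by (field; lra). nra. }
specialize (Hw Hlt).
rewrite norm_C_R, scal_R_Cmult.
change (Cmod (f (seg a b y) - f (seg a b t) - RtoC (y - t) * (l * (b - a))) <= eps * Rabs (y - t)).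
replace (RtoC (y - t) * (l * (b - a)))%C with (l * (RtoC (y - t) * (b - a)))%C by ring.
eapply Rle_trans; [exact Hw|].
replace (eps / (1 + Cmod (b - a)) * (Rabs (y - t) * Cmod (b - a)))
  with (eps * Rabs (y - t) * (Cmod (b - a) / (1 + Cmod (b - a)))) by (field; lra).
rewrite <- (Rmult_1_r (eps * Rabs (y - t))) at 2.
apply Rmult_le_compat_l; [nra|]. apply Rle_div_l; lra.
Qed.

Lemma is_derive_fst (g : R -> C) (t : R) (l : C) :
  is_derive (V := C_R_NormedModule) g t l -> is_derive (fun s => fst (g s)) t (fst l).
Proof.
intros H. apply is_derive_eps; intros eps Heps.
destruct (proj1 (is_derive_eps _ _ _) H eps Heps) as [d [Hd Hw]].
exists d; split; [easy|]. intros y Hy. specialize (Hw y Hy).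
rewrite norm_C_R in Hw. eapply Rle_trans; [|exact Hw].
exact (fst_le_Cmod (minus (minus (g y) (g t)) (scal (V:=C_R_NormedModule) (y - t) l))).
Qed.

Lemma is_derive_snd (g : R -> C) (t : R) (l : C) :
  is_derive (V := C_R_NormedModule) g t l -> is_derive (fun s => snd (g s)) t (snd l).
Proof.
intros H. apply is_derive_eps; intros eps Heps.
destruct (proj1 (is_derive_eps _ _ _) H eps Heps) as [d [Hd Hw]].
exists d; split; [easy|]. intros y Hy. specialize (Hw y Hy).
rewrite norm_C_R in Hw. eapply Rle_trans; [|exact Hw].
exact (snd_le_Cmod (minus (minus (g y) (g t)) (scal (V:=C_R_NormedModule) (y - t) l))).
Qed.

Lemma mean_value_le (f df : C -> C) (a b : C) (K : R) :
  (forall t, 0 <= t <= 1 -> is_cderive f (seg a b t) (df (seg a b t))) ->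
  (forall t, 0 <= t <= 1 -> Cmod (df (seg a b t)) <= K) ->
  Cmod (f b - f a) <= K * Cmod (b - a).
Proof.
intros Hd HK. set (D := (f b - f a)%C).
(* Projecting onto the direction of the total increment reduces to the real theorem. *)
pose (phi := fun t => fst (Cconj D * f (seg a b t))%C).
assert (Hphi : forall t, 0 <= t <= 1 ->
  is_derive phi t (fst (Cconj D * df (seg a b t) * (b - a))%C)).
{ intros t Ht. apply is_derive_fst.
  apply (is_derive_seg (fun z => Cconj D * f z)%C).
  eapply is_cderive_ext; [reflexivity| |
    apply (is_cderive_mult (fun _ => Cconj D)); [apply is_cderive_const|apply Hd, Ht]].
  ring. }
destruct (MVT_gen phi 0 1 (fun t => fst (Cconj D * df (seg a b t) * (b - a))%C)) as [c [Hc E]].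
- rewrite Rmin_left, Rmax_right by lra. intros x Hx. apply Hphi; lra.
- rewrite Rmin_left, Rmax_right by lra. intros x Hx.
  apply derivable_continuous_pt. eexists. apply is_derive_Reals, Hphi; lra.
- rewrite Rmin_left, Rmax_right in Hc by lra.
  rewrite Rminus_0_r, Rmult_1_r in E. unfold phi in E. rewrite seg_0, seg_1 in E.
  assert (E2 : Cmod D * Cmod D = fst (Cconj D * f b)%C - fst (Cconj D * f a)%C).
  { transitivity (fst (Cconj D * D)%C).
    - transitivity (Cmod D ^ 2); [simpl; ring|].
      rewrite Cmod2_alt. unfold Re, Im, Cconj, Cmult; simpl; ring.
    - unfold D at 2. unfold Cmult, Cminus, Cplus, Copp, Cconj; simpl; ring. }
  rewrite E in E2.
  pose proof (Rle_trans _ _ _ (Rle_abs _) (fst_le_Cmod (Cconj D * df (seg a b c) * (b - a))%C)) as B.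
  rewrite !Cmod_mult, Cmod_conj in B.
  pose proof (HK c Hc) as Hk. pose proof (Cmod_ge_0 D). pose proof (Cmod_ge_0 (b - a)).
  destruct (Req_dec (Cmod D) 0) as [E0|E0].
  + rewrite E0. pose proof (Cmod_ge_0 (df (seg a b c))). apply Rmult_le_pos; lra.
  + apply (Rmult_le_reg_l (Cmod D)); [lra|]. rewrite E2.
    eapply Rle_trans; [exact B|].
    rewrite Rmult_assoc. apply Rmult_le_compat_l; [lra|]. now apply Rmult_le_compat_r.
Qed.

Definition convex (U : C -> Prop) : Prop :=
  forall a b t, U a -> U b -> 0 <= t <= 1 -> U (seg a b t).

Lemma Cmod_seg_le (a b c : C) (t r : R) : 0 <= t <= 1 ->
  Cmod (a - c) <= r -> Cmod (b - c) <= r -> Cmod (seg a b t - c) <= r.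
Proof.
intros Ht Ha Hb.
replace (seg a b t - c)%C with (RtoC (1 - t) * (a - c) + RtoC t * (b - c))%C
  by (unfold seg; rewrite RtoC_minus; ring).
eapply Rle_trans; [apply Cmod_triangle|]. rewrite !Cmod_mult, !Cmod_R, !Rabs_right by lra. nra.
Qed.

Definition cball (a : C) (r : R) (z : C) : Prop := Cmod (z - a) <= r.

Definition oball (a : C) (r : R) (z : C) : Prop := Cmod (z - a) < r.

Lemma oball_center (a : C) (r : R) : 0 < r -> oball a r a.
Proof. intros Hr. unfold oball. replace (a - a)%C with (RtoC 0) by ring. now rewrite Cmod_0. Qed.

Lemma cball_convex (a : C) (r : R) : convex (cball a r).
Proof. intros u v t Hu Hv Ht. now apply Cmod_seg_le. Qed.

Lemma oball_convex (a : C) (r : R) : convex (oball a r).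
Proof.
intros u v t Hu Hv Ht. unfold oball in *.
apply Rle_lt_trans with (Rmax (Cmod (u - a)) (Cmod (v - a))).
- apply Cmod_seg_le; [easy|apply Rmax_l|apply Rmax_r].
- now apply Rmax_lub_lt.
Qed.

Lemma mean_value_le_convex (U : C -> Prop) (f df : C -> C) (K : R) (z w : C) :
  convex U -> (forall x, U x -> is_cderive f x (df x)) ->
  (forall x, U x -> Cmod (df x) <= K) -> U z -> U w ->
  Cmod (f w - f z) <= K * Cmod (w - z).
Proof.
intros HU Hd HK Hz Hw. apply mean_value_le with df.
- intros t Ht. apply Hd. now apply HU.
- intros t Ht. apply HK. now apply HU.
Qed.

(** The mean value inequality for [f z - m z]: a derivative within [B] of [m] makes [f] within [B] of
    being linear of slope [m]. *)
Lemma linear_approximation (U : C -> Prop) (f df : C -> C) (m : C) (B : R) (z w : C) :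
  convex U -> (forall x, U x -> is_cderive f x (df x)) -> U z -> U w ->
  (forall x, U x -> Cmod (df x - m) <= B) ->
  Cmod (f w - f z - m * (w - z)) <= B * Cmod (w - z).
Proof.
intros HU Hd Hz Hw HB.
replace (f w - f z - m * (w - z))%C with ((f w - m * w) - (f z - m * z))%C by ring.
apply (mean_value_le_convex U (fun x => f x - m * x)%C (fun x => df x - m)%C); try easy.
intros x Hx. apply is_cderive_minus; [now apply Hd|].
eapply is_cderive_ext; [reflexivity| |apply (is_cderive_scal m (fun x => x)), is_cderive_id]. ring.
Qed.

(** * Integrals along segments *)

Notation Cint f := (RInt (V := C_R_CompleteNormedModule) f 0 1).

Notation is_Cint f l := (is_RInt (V := C_R_NormedModule) f 0 1 l).

Lemma is_Cint_plus (f g : R -> C) (a b : C) :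
  is_Cint f a -> is_Cint g b -> is_Cint (fun t => f t + g t)%C (a + b)%C.
Proof. exact (is_RInt_plus (V := C_R_NormedModule) f g 0 1 a b). Qed.

Lemma is_Cint_mult (f : R -> C) (c l : C) :
  is_Cint f l -> is_Cint (fun t => c * f t)%C (c * l)%C.
Proof.
intros H.
pose proof (is_RInt_fct_extend_fst (U := R_NormedModule) (V := R_NormedModule) f 0 1 l H) as H1.
pose proof (is_RInt_fct_extend_snd (U := R_NormedModule) (V := R_NormedModule) f 0 1 l H) as H2.
apply (is_RInt_fct_extend_pair (U := R_NormedModule) (V := R_NormedModule)); simpl.
- exact (is_RInt_minus _ _ _ _ _ _ (is_RInt_scal _ _ _ (fst c) _ H1) (is_RInt_scal _ _ _ (snd c) _ H2)).
- exact (is_RInt_plus _ _ _ _ _ _ (is_RInt_scal _ _ _ (fst c) _ H2) (is_RInt_scal _ _ _ (snd c) _ H1)).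
Qed.

Lemma is_Cint_bound (f : R -> C) (l : C) (M : R) :
  is_Cint f l -> (forall t, 0 <= t <= 1 -> Cmod (f t) <= M) -> Cmod l <= M.
Proof.
intros H HM. rewrite <- norm_C_R. replace M with ((1 - 0) * M) by ring.
apply (norm_RInt_le_const (V := C_R_NormedModule) f 0 1 l M); [lra| |exact H].
intros x Hx. rewrite norm_C_R. now apply HM.
Qed.

Lemma is_Cint_unique (f : R -> C) (l : C) : is_Cint f l -> Cint f = l.
Proof. exact (is_RInt_unique (V := C_R_CompleteNormedModule) f 0 1 l). Qed.

Lemma continuous_seg (f : C -> C) (a b : C) (t : R) :
  Ccont f (seg a b t) -> continuous (U := C_R_NormedModule) (fun s => f (seg a b s)) t.
Proof.
intros H. apply filterlim_locally. intros eps.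
destruct (H eps (cond_pos eps)) as [d [Hd Hw]].
pose proof (Cmod_ge_0 (b - a)) as Hba.
assert (Hd' : 0 < d / (1 + Cmod (b - a))) by (apply Rdiv_lt_0_compat; lra).
exists (mkposreal _ Hd'). intros y Hy.
apply (C_NormedModule_mixin_compat1 (f (seg a b t)) (f (seg a b y))).
apply Hw. replace (seg a b y - seg a b t)%C with (RtoC (y - t) * (b - a))%C
  by (unfold seg; rewrite RtoC_minus; ring).
rewrite Cmod_mult, Cmod_R.
change (Rabs (y - t) < d / (1 + Cmod (b - a))) in Hy.
pose proof (Rabs_pos (y - t)).
apply (Rmult_lt_compat_r (1 + Cmod (b - a))) in Hy; [|lra].
replace (d / (1 + Cmod (b - a)) * (1 + Cmod (b - a))) with d in Hy by (field; lra). nra.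
Qed.

Definition cont_seg (f : C -> C) (a b : C) : Prop :=
  forall t, 0 <= t <= 1 -> Ccont f (seg a b t).

Lemma is_Cint_seg (f : C -> C) (a b : C) : cont_seg f a b ->
  is_Cint (fun t => f (seg a b t)) (Cint (fun t => f (seg a b t))).
Proof.
intros H. apply (RInt_correct (V := C_R_CompleteNormedModule)).
apply (ex_RInt_continuous (V := C_R_CompleteNormedModule)).
rewrite Rmin_left, Rmax_right by lra. intros z Hz. now apply continuous_seg, H.
Qed.

(** The integral of [f] along the segment from [a] to [b], with the constant velocity taken
    out of the integral. *)
Definition lint (f : C -> C) (a b : C) : C := ((b - a) * Cint (fun t => f (seg a b t)))%C.

Lemma lint_bound (f : C -> C) (a b : C) (M : R) : cont_seg f a b ->
  (forall t, 0 <= t <= 1 -> Cmod (f (seg a b t)) <= M) ->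
  Cmod (lint f a b) <= Cmod (b - a) * M.
Proof.
intros Hc HM. unfold lint. rewrite Cmod_mult.
apply Rmult_le_compat_l; [apply Cmod_ge_0|].
exact (is_Cint_bound _ _ _ (is_Cint_seg f a b Hc) HM).
Qed.

Lemma lint_minus (f g : C -> C) (a b : C) : cont_seg f a b -> cont_seg g a b ->
  lint (fun z => f z - g z)%C a b = (lint f a b - lint g a b)%C.
Proof.
intros Hf Hg. unfold lint.
rewrite (is_Cint_unique (fun t => f (seg a b t) - g (seg a b t))%C
  (Cint (fun t => f (seg a b t)) + (- (1)) * Cint (fun t => g (seg a b t)))%C).
- ring.
- eapply is_RInt_ext; [|apply is_Cint_plus; [apply is_Cint_seg, Hf|apply is_Cint_mult, is_Cint_seg, Hg]].
  intros x _. simpl. ring.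
Qed.

Lemma lint_derive (F f : C -> C) (a b : C) :
  (forall t, 0 <= t <= 1 -> is_cderive F (seg a b t) (f (seg a b t))) ->
  cont_seg f a b -> lint f a b = (F b - F a)%C.
Proof.
intros HF Hc.
assert (H : is_Cint (fun t => (b - a) * f (seg a b t))%C (F (seg a b 1) - F (seg a b 0))%C).
{ apply (is_RInt_derive (V := C_R_CompleteNormedModule) (fun t => F (seg a b t))).
  - rewrite Rmin_left, Rmax_right by lra. intros x Hx.
    rewrite Cmult_comm. now apply is_derive_seg, HF.
  - rewrite Rmin_left, Rmax_right by lra. intros x Hx.
    apply (continuous_seg (fun z => (b - a) * f z)%C).
    intros eps Heps. pose proof (Cmod_ge_0 (b - a)).
    destruct (Hc x Hx (eps / (1 + Cmod (b - a)))) as [d [Hd Hw]].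
    { apply Rdiv_lt_0_compat; lra. }
    exists d; split; [easy|]. intros w Hwz. specialize (Hw w Hwz).
    replace ((b - a) * f w - (b - a) * f (seg a b x))%C
      with ((b - a) * (f w - f (seg a b x)))%C by ring.
    rewrite Cmod_mult. pose proof (Cmod_ge_0 (f w - f (seg a b x))).
    apply (Rmult_lt_compat_r (1 + Cmod (b - a))) in Hw; [|lra].
    replace (eps / (1 + Cmod (b - a)) * (1 + Cmod (b - a))) with eps in Hw by (field; lra).
    nra. }
rewrite seg_0, seg_1 in H.
pose proof (is_Cint_mult _ (b - a)%C _ (is_Cint_seg f a b Hc)) as H'.
unfold lint. rewrite <- (is_Cint_unique _ _ H). symmetry. now apply is_Cint_unique.
Qed.

Lemma lint_const (c a b : C) : lint (fun _ => c) a b = (c * (b - a))%C.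
Proof.
rewrite (lint_derive (fun z => c * z)%C); [ring| |].
- intros t _. eapply is_cderive_ext; [reflexivity| |apply (is_cderive_scal c (fun z => z)), is_cderive_id]. ring.
- intros t _. exact (Ccont_derive _ _ _ (is_cderive_const c _)).
Qed.

(** Reversing a segment ([u = -1], [v = 1]) and halving it ([u = 1/2]) are both affine changes of
    the parameter. *)
Lemma Cint_affine (f : C -> C) (a b : C) (u v : R) : cont_seg f a b ->
  0 <= v <= 1 -> 0 <= u + v <= 1 ->
  is_RInt (V := C_R_NormedModule) (fun t => f (seg a b t)) v (u + v) 
    (RtoC u * Cint (fun t => f (seg (seg a b v) (seg a b (u + v)) t)))%C.
Proof.
intros H Hv Huv.
assert (Hex : ex_RInt (V := C_R_CompleteNormedModule) (fun t => f (seg a b t)) v (u + v)).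
{ apply (ex_RInt_continuous (V := C_R_CompleteNormedModule)). intros z Hz.
  apply continuous_seg, H. revert Hz. unfold Rmin, Rmax. destruct (Rle_dec v (u + v)); lra. }
destruct Hex as [l Hl].
pose proof (is_RInt_comp_lin (V := C_R_NormedModule) (fun t => f (seg a b t)) u v 0 1 l) as K.
rewrite Rmult_0_r, Rplus_0_l, Rmult_1_r in K. specialize (K Hl).
replace (RtoC u * _)%C with l; [exact Hl|].
assert (Hs : cont_seg f (seg a b v) (seg a b (u + v))).
{ intros t Ht. replace (seg (seg a b v) (seg a b (u + v)) t) with (seg a b (u * t + v)).
  - apply H. nra.
  - unfold seg. rewrite !RtoC_plus, RtoC_mult. ring. }
pose proof (is_Cint_mult _ (RtoC u) _ (is_Cint_seg f _ _ Hs)) as K'.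
rewrite <- (is_Cint_unique _ _ K'). symmetry. apply is_Cint_unique.
eapply is_RInt_ext; [|exact K]. intros x _. simpl.
rewrite scal_R_Cmult. do 2 f_equal. unfold seg. rewrite !RtoC_plus, RtoC_mult. ring.
Qed.

Lemma lint_rev (f : C -> C) (a b : C) : cont_seg f a b -> lint f b a = (- lint f a b)%C.
Proof.
intros H. pose proof (Cint_affine f a b (-1) 1 H ltac:(lra) ltac:(lra)) as K.
replace (-1 + 1) with 0 in K by ring. rewrite seg_0, seg_1 in K.
apply is_RInt_swap in K.
pose proof (is_RInt_unique (V := C_R_CompleteNormedModule) _ _ _ _ K) as E.
unfold lint. rewrite E. change (opp (?x : C)) with (- x)%C.
replace (RtoC (-1)) with (- (1))%C by (unfold RtoC, Copp; simpl; f_equal; ring).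
ring.
Qed.

Definition mid (a b : C) : C := ((a + b) / 2)%C.

Lemma seg_mid (a b : C) : seg a b (1 / 2) = mid a b.
Proof. unfold seg, mid. rewrite RtoC_div by lra. field. Qed.

Lemma lint_mid (f : C -> C) (a b : C) : cont_seg f a b ->
  lint f a b = (lint f a (mid a b) + lint f (mid a b) b)%C.
Proof.
intros H.
pose proof (Cint_affine f a b (1/2) 0 H ltac:(lra) ltac:(lra)) as K1.
pose proof (Cint_affine f a b (1/2) (1/2) H ltac:(lra) ltac:(lra)) as K2.
rewrite Rplus_0_r in K1. replace (1/2 + 1/2) with 1 in K2 by field.
rewrite seg_0, seg_1, seg_mid in *.
pose proof (is_RInt_Chasles (V := C_R_NormedModule) _ _ _ _ _ _ K1 K2) as K.
unfold lint at 1. rewrite (is_Cint_unique _ _ K).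
change (plus ?x ?y : C) with (x + y)%C.
unfold lint, mid. rewrite RtoC_div by lra. field.
Qed.

(** * Descent in the complete plane *)

Lemma pow2_unbounded (x : R) : exists n : nat, x < 2 ^ n.
Proof.
destruct (Pow_x_infinity 2) with (b := x + 1) as [N HN].
- rewrite Rabs_right; lra.
- exists N. specialize (HN N (Nat.le_refl N)).
  rewrite Rabs_right in HN; [lra|]. apply Rle_ge, pow_le; lra.
Qed.

Lemma geometric_limit (u : nat -> C) (c : R) :
  (forall n, Cmod (u (S n) - u n) <= c / 2 ^ n) ->
  exists l, forall n, Cmod (l - u n) <= 2 * c / 2 ^ n.
Proof.
intros H.
assert (Hex : ex_series (V := C_R_CompleteNormedModule) (fun n => (u (S n) - u n)%C)).
{ apply (ex_series_le (V := C_R_CompleteNormedModule) _ (fun n => c * (/ 2) ^ n)).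
  - intros n. eapply Rle_trans; [|rewrite pow_inv; apply H].
    right. exact (norm_C_R (u (S n) - u n)%C).
  - apply (ex_series_scal (V := R_NormedModule) c), ex_series_geom.
    rewrite Rabs_right; lra. }
destruct Hex as [s Hs].
assert (Hsum : forall n, sum_n (G := C_R_NormedModule) (fun n => (u (S n) - u n)%C) n = (u (S n) - u O)%C).
{ induction n as [|n IH]; [now rewrite sum_O|].
  rewrite sum_Sn, IH.
  change (@eq C ((u (S n) - u O) + (u (S (S n)) - u (S n))) (u (S (S n)) - u O))%C. ring. }
assert (Hdist : forall n k, Cmod (u (n + k)%nat - u n) <= 2 * c / 2 ^ n - 2 * c / 2 ^ (n + k)).
{ intros n; induction k as [|k IH].
  - rewrite Nat.add_0_r. replace (u n - u n)%C with (RtoC 0) by ring. rewrite Cmod_0. lra.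
  - rewrite Nat.add_succ_r.
    replace (u (S (n + k)) - u n)%C
      with ((u (S (n + k)) - u (n + k)%nat) + (u (n + k)%nat - u n))%C by ring.
    eapply Rle_trans; [apply Cmod_triangle|]. specialize (H (n + k)%nat).
    simpl pow. assert (0 < 2 ^ (n + k)) by (apply pow_lt; lra).
    replace (2 * c / (2 * 2 ^ (n + k))) with (2 * c / 2 ^ (n + k) - c / 2 ^ (n + k)) by (field; lra).
    lra. }
assert (Hc : 0 <= c).
{ specialize (H O). pose proof (Cmod_ge_0 (u 1%nat - u O)). simpl in H. lra. }
exists (s + u O)%C. intros n. apply le_epsilon. intros eps Heps.
assert (He : 0 < eps / 2) by lra.
destruct (proj1 (filterlim_locally _ _) Hs (mkposreal _ He)) as [N HN].
specialize (HN (n + N)%nat ltac:(lia)). rewrite Hsum in HN.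
apply (C_NormedModule_mixin_compat2 s (u (S (n + N)) - u O)%C) in HN. simpl in HN.
change (minus ?x ?y : C) with (x - y)%C in HN.
specialize (Hdist n (S N)). rewrite Nat.add_succ_r in Hdist.
replace (s + u O - u n)%C with ((u (S (n + N)) - u n) + - (u (S (n + N)) - u O - s))%C by ring.
eapply Rle_trans; [apply Cmod_triangle|]. rewrite Cmod_opp.
assert (0 <= 2 * c / 2 ^ (S (n + N))).
{ apply Rdiv_le_0_compat; [lra|]. apply pow_lt; lra. }
assert (Hq : sqrt 2 <= 2).
{ pose proof (sqrt_sqrt 2 ltac:(lra)). pose proof (sqrt_pos 2). nra. }
assert (sqrt 2 * (eps / 2) <= eps) by nra.
lra.
Qed.

(** The common pattern of the nested triangles in Goursat's theorem, of the choice of centre in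
    Bloch's theorem and of Newton's iteration: points refined along steps that decrease
    geometrically converge. *)
Lemma complete_descent (P : nat -> C -> Prop) (c : R) (x0 : C) :
  P O x0 ->
  (forall n x, P n x -> exists y, P (S n) y /\ Cmod (y - x) <= c / 2 ^ n) ->
  exists l, forall n, exists x, P n x /\ Cmod (l - x) <= 2 * c / 2 ^ n.
Proof.
intros H0 Hstep.
pose (next := fun n (s : {x | P n x}) =>
  let (y, Hy) := constructive_indefinite_description _ (Hstep n (proj1_sig s) (proj2_sig s)) in
  exist (P (S n)) y (proj1 Hy)).
assert (Hnext : forall n s, Cmod (proj1_sig (next n s) - proj1_sig s) <= c / 2 ^ n).
{ intros n s. unfold next.
  destruct (constructive_indefinite_description _ _) as [y [Hy1 Hy2]]. exact Hy2. }
pose (v := fix v n : {x | P n x} :=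
  match n return {x | P n x} with O => exist _ x0 H0 | S m => next m (v m) end).
destruct (geometric_limit (fun n => proj1_sig (v n)) c) as [l Hl].
- intros n. apply (Hnext n (v n)).
- exists l. intros n. exists (proj1_sig (v n)). split; [apply (proj2_sig (v n))|apply Hl].
Qed.

(** * Goursat's theorem and primitives *)

Definition seq_closed (U : C -> Prop) : Prop :=
  forall l, (forall eps, 0 < eps -> exists x, U x /\ Cmod (l - x) < eps) -> U l.

Definition differentiable_on (U : C -> Prop) (f : C -> C) : Prop :=
  forall z, U z -> exists l, is_cderive f z l.

Definition tri (f : C -> C) (a b c : C) : C := (lint f a b + lint f b c + lint f c a)%C.

Definition perim (a b c : C) : R := Cmod (b - a) + Cmod (c - b) + Cmod (a - c).

Lemma cont_seg_differentiable (U : C -> Prop) (f : C -> C) (a b : C) :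
  convex U -> differentiable_on U f -> U a -> U b -> cont_seg f a b.
Proof.
intros HU Hf Ha Hb t Ht. destruct (Hf _ (HU a b t Ha Hb Ht)) as [l Hl].
exact (Ccont_derive _ _ _ Hl).
Qed.

Lemma Cmod_half (z : C) : Cmod (z / 2) = Cmod z / 2.
Proof.
rewrite Cmod_div by (intros E; apply (f_equal fst) in E; simpl in E; lra).
rewrite Cmod_R, Rabs_right; lra.
Qed.

(** The midpoints of the sides cut a triangle into four of half the perimeter whose integrals add
    up to the given one, so one of the four carries at least a quarter of it. *)
Lemma tri_subdivide (f : C -> C) (U : C -> Prop) (a b c : C) :
  convex U -> differentiable_on U f -> U a -> U b -> U c ->
  exists x y z, U x /\ U y /\ U z /\ perim x y z = perim a b c / 2 /\
    Cmod (x - a) <= perim a b c /\ Cmod (tri f a b c) / 4 <= Cmod (tri f x y z).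
Proof.
intros HU Hf Ha Hb Hc.
assert (Hm : forall u v, U u -> U v -> U (mid u v)).
{ intros u v Hu Hv. rewrite <- seg_mid. apply HU; try easy; lra. }
assert (Hcs : forall u v, U u -> U v -> cont_seg f u v)
  by (intros u v Hu Hv; exact (cont_seg_differentiable U f u v HU Hf Hu Hv)).
pose proof (Hm a b Ha Hb) as Hab. pose proof (Hm b c Hb Hc) as Hbc.
pose proof (Hm c a Hc Ha) as Hca.
set (T1 := tri f a (mid a b) (mid c a)). set (T2 := tri f (mid a b) b (mid b c)).
set (T3 := tri f (mid c a) (mid b c) c). set (T4 := tri f (mid a b) (mid b c) (mid c a)).
(* The three sides of the medial triangle are each run through once in both directions. *)
assert (E : tri f a b c = (T1 + T2 + (T3 + T4))%C).
{ unfold T1, T2, T3, T4, tri.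
  rewrite (lint_mid f a b), (lint_mid f b c), (lint_mid f c a) by auto.
  rewrite (lint_rev f (mid a b) (mid b c)), (lint_rev f (mid c a) (mid a b)),
    (lint_rev f (mid b c) (mid c a)) by auto.
  ring. }
assert (E4 : Cmod (tri f a b c) <= Cmod T1 + Cmod T2 + (Cmod T3 + Cmod T4)).
{ rewrite E. eapply Rle_trans; [apply Cmod_triangle|].
  apply Rplus_le_compat; apply Cmod_triangle. }
assert (P : forall u v, Cmod (u / 2 - v / 2) = Cmod (u - v) / 2).
{ intros u v. rewrite <- Cmod_half. f_equal. unfold Cdiv; ring. }
assert (D1 : (mid a b - a = (b - a) / 2)%C) by (unfold mid; field).
assert (D2 : (mid c a - mid a b = (c - b) / 2)%C) by (unfold mid; field).
assert (D3 : (a - mid c a = (a - c) / 2)%C) by (unfold mid; field).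
assert (D4 : (b - mid a b = (b - a) / 2)%C) by (unfold mid; field).
assert (D5 : (mid b c - b = (c - b) / 2)%C) by (unfold mid; field).
assert (D6 : (mid a b - mid b c = (a - c) / 2)%C) by (unfold mid; field).
assert (D7 : (mid b c - mid c a = (b - a) / 2)%C) by (unfold mid; field).
assert (D8 : (c - mid b c = (c - b) / 2)%C) by (unfold mid; field).
assert (D9 : (mid c a - c = (a - c) / 2)%C) by (unfold mid; field).
assert (D10 : (mid c a - a = - ((a - c) / 2))%C) by (unfold mid; field).
pose proof (Cmod_ge_0 (b - a)). pose proof (Cmod_ge_0 (c - b)). pose proof (Cmod_ge_0 (a - c)).
destruct (Rle_dec (Cmod (tri f a b c) / 4) (Cmod T1)) as [Q1|Q1];
[|destruct (Rle_dec (Cmod (tri f a b c) / 4) (Cmod T2)) as [Q2|Q2];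
[|destruct (Rle_dec (Cmod (tri f a b c) / 4) (Cmod T3)) as [Q3|Q3];
[|destruct (Rle_dec (Cmod (tri f a b c) / 4) (Cmod T4)) as [Q4|Q4]; [|lra]]]].
- exists a, (mid a b), (mid c a). do 3 (split; [assumption|]). unfold perim.
  rewrite D1, D2, D3, !Cmod_half. replace (a - a)%C with (RtoC 0) by ring. rewrite Cmod_0.
  repeat split; lra || assumption.
- exists (mid a b), b, (mid b c). do 3 (split; [assumption|]). unfold perim.
  rewrite D1, D4, D5, D6, !Cmod_half. repeat split; lra || assumption.
- exists (mid c a), (mid b c), c. do 3 (split; [assumption|]). unfold perim.
  rewrite D7, D8, D9, D10, Cmod_opp, !Cmod_half. repeat split; lra || assumption.
- exists (mid a b), (mid b c), (mid c a). do 3 (split; [assumption|]). unfold perim.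
  replace (mid b c - mid a b)%C with (- ((a - c) / 2))%C by (rewrite <- D6; ring).
  replace (mid c a - mid b c)%C with (- ((b - a) / 2))%C by (rewrite <- D7; ring).
  replace (mid a b - mid c a)%C with (- ((c - b) / 2))%C by (rewrite <- D2; ring).
  rewrite D1, !Cmod_opp, !Cmod_half. repeat split; lra || assumption.
Qed.

Lemma tri_affine (p q l a b c : C) : tri (fun w => p + q * (w - l))%C a b c = 0.
Proof.
assert (H : forall u v, lint (fun w => p + q * (w - l))%C u v
  = ((p * v + q * ((v - l) * (v - l) / 2)) - (p * u + q * ((u - l) * (u - l) / 2)))%C).
{ intros u v. 
  apply (lint_derive (fun w => p * w + q * ((w - l) * (w - l) / 2))%C).
  - intros t _. set (z := seg u v t).
    eapply is_cderive_ext with (f := fun w => (p * w + q / 2 * ((w - l) * (w - l)))%C)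
      (a := ((0 * z + p * 1) + (0 * ((z - l) * (z - l)) + q / 2 * ((1 + 0) * (z - l) + (z - l) * (1 + 0))))%C);
      [intros; field|field|].
    assert (Hl : is_cderive (fun w => w - l)%C z (1 + 0)%C)
      by (apply (is_cderive_plus (fun w => w) (fun _ => - l)%C); [apply is_cderive_id|apply is_cderive_const]).
    apply (is_cderive_plus (fun w => p * w)%C).
    + apply (is_cderive_mult (fun _ => p)); [apply is_cderive_const|apply is_cderive_id].
    + apply (is_cderive_mult (fun _ => q / 2)%C (fun w => (w - l) * (w - l))%C); [apply is_cderive_const|].
      now apply (is_cderive_mult (fun w => w - l)%C (fun w => w - l)%C).
  - intros t _. exact (Ccont_derive _ _ _ (is_cderive_affine p q l _)). }
unfold tri. rewrite !H. field.
Qed.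

(** If the integral over the triangle were nonzero, repeated subdivision would produce triangles of
    perimeter at most [d / 2^n], shrinking to a point [l], with integral at least [T / 4^n] in modulus; but
    near [l] the function is affine up to [eps |w - l|], which gives at most [3 eps d^2 / 4^n]. *)
Lemma goursat (U : C -> Prop) (f : C -> C) (a b c : C) :
  convex U -> seq_closed U -> differentiable_on U f ->
  U a -> U b -> U c -> tri f a b c = 0.
Proof.
intros HU HU' Hf Ha Hb Hc. apply Cmod_eq_0.
destruct (Rle_lt_or_eq_dec 0 _ (Cmod_ge_0 (tri f a b c))) as [HT|]; [exfalso|easy].
(* The 1 keeps d positive when the triangle is a single point. *)
set (T := Cmod (tri f a b c)) in *. set (d := perim a b c + 1).
assert (Hd : 1 <= d).
{ unfold d, perim. pose proof (Cmod_ge_0 (b - a)).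
  pose proof (Cmod_ge_0 (c - b)). pose proof (Cmod_ge_0 (a - c)). lra. }
assert (Hp2 : forall n, 0 < 2 ^ n) by (intros; apply pow_lt; lra).
destruct (complete_descent (fun n x => exists y z, U x /\ U y /\ U z /\
  perim x y z <= d / 2 ^ n /\ T / 4 ^ n <= Cmod (tri f x y z)) d a) as [l Hl].
- exists b, c. repeat split; try easy; simpl; unfold T, d; lra.
- intros n x (y & z & Hx & Hy & Hz & Hper & Htri).
  destruct (tri_subdivide f U x y z HU Hf Hx Hy Hz) as (x' & y' & z' & Hx' & Hy' & Hz' & Hp & Hxx & Ht).
  exists x'; split; [|lra]. exists y', z'. do 3 (split; [assumption|]). split.
  + rewrite Hp. simpl. replace (d / (2 * 2 ^ n)) with (d / 2 ^ n / 2); [lra|].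
    specialize (Hp2 n). field. lra.
  + simpl. assert (0 < 4 ^ n) by (apply pow_lt; lra).
    replace (T / (4 * 4 ^ n)) with (T / 4 ^ n / 4) by (field; lra). lra.
- assert (Hin : U l).
  { apply HU'. intros eps Heps.
    destruct (pow2_unbounded (2 * d / eps)) as [n Hn].
    destruct (Hl n) as (x & (y & z & Hx & _) & Hx'). exists x; split; [easy|].
    eapply Rle_lt_trans; [exact Hx'|]. specialize (Hp2 n).
    apply Rlt_div_l; [easy|]. apply Rlt_div_l in Hn; lra. }
  destruct (Hf l Hin) as [m Hm].
  assert (Heps : 0 < T / (4 * d * d)) by (apply Rdiv_lt_0_compat; nra).
  destruct (proj1 (is_cderive_eps _ _ _) Hm _ Heps) as [delta [Hdelta Hw]].
  destruct (pow2_unbounded (3 * d / delta)) as [n Hn].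
  destruct (Hl n) as (x & (y & z & Hx & Hy & Hz & Hper & Htri) & Hlx). clear Hl.
  specialize (Hp2 n).
  assert (Hsmall : 3 * (d / 2 ^ n) < delta).
  { replace (3 * (d / 2 ^ n)) with (3 * d / 2 ^ n) by (field; lra).
    apply Rlt_div_l; [easy|]. apply Rlt_div_l in Hn; lra. }
  set (eps := T / (4 * d * d)) in *.
  set (D := d / 2 ^ n) in *.
  assert (Hlx' : Cmod (x - l) <= 2 * D).
  { rewrite <- Cmod_opp. replace (- (x - l))%C with (l - x)%C by ring.
    unfold D. replace (2 * (d / 2 ^ n)) with (2 * d / 2 ^ n) by (field; lra). easy. }
  (* The affine part of f at l contributes nothing, so only the remainder is estimated. *)
  set (A := fun w => (f l + m * (w - l))%C).
  assert (HcA : forall u v, cont_seg A u v).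
  { intros u v t _. exact (Ccont_derive _ _ _ (is_cderive_affine (f l) m l _)). }
  assert (Hcf : forall u v, U u -> U v -> cont_seg f u v)
    by (intros u v Hu Hv; exact (cont_seg_differentiable U f u v HU Hf Hu Hv)).
  pose proof (Cmod_ge_0 (y - x)) as P1. pose proof (Cmod_ge_0 (z - y)) as P2.
  pose proof (Cmod_ge_0 (x - z)) as P3. unfold perim in Hper.
  assert (HB : forall u v, U u -> U v -> Cmod (u - l) + Cmod (v - u) <= 3 * D ->
    Cmod (lint f u v - lint A u v) <= Cmod (v - u) * (eps * (3 * D))).
  { intros u v Hu Hv Hdist. rewrite <- lint_minus; auto. apply lint_bound.
    - intros t Ht.
      destruct (Hf _ (HU u v t Hu Hv Ht)) as [l1 Hl1].
      assert (K : is_cderive (fun w => f w - A w)%C (seg u v t) (l1 + (0 * A (seg u v t) + (- (1)) * m))%C).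
      { eapply is_cderive_ext with (f := fun w => (f w + (- (1)) * A w)%C); [intros; ring|reflexivity|].
        apply (is_cderive_plus f); [easy|].
        apply (is_cderive_mult (fun _ => - (1))%C A); [apply is_cderive_const|apply is_cderive_affine]. }
      exact (Ccont_derive _ _ _ K).
    - intros t Ht.
      assert (Hs : Cmod (seg u v t - l) <= 3 * D).
      { replace (seg u v t - l)%C with ((seg u v t - u) + (u - l))%C by ring.
        eapply Rle_trans; [apply Cmod_triangle|]. pose proof (Cmod_seg u v t Ht). lra. }
      specialize (Hw (seg u v t) ltac:(lra)).
      unfold A. replace (f (seg u v t) - (f l + m * (seg u v t - l)))%C
        with (f (seg u v t) - f l - m * (seg u v t - l))%C by ring.
      eapply Rle_trans; [exact Hw|]. apply Rmult_le_compat_l; lra. }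
  assert (Hyl : Cmod (y - l) <= Cmod (y - x) + Cmod (x - l)).
  { replace (y - l)%C with ((y - x) + (x - l))%C by ring. apply Cmod_triangle. }
  assert (Hzl : Cmod (z - l) <= Cmod (x - z) + Cmod (x - l)).
  { replace (z - l)%C with (- (x - z) + (x - l))%C by ring.
    eapply Rle_trans; [apply Cmod_triangle|]. rewrite Cmod_opp. lra. }
  (* A side is at most the sum of the other two, hence at most half of the perimeter. *)
  assert (Hxz : Cmod (x - z) <= Cmod (y - x) + Cmod (z - y)).
  { rewrite <- (Cmod_opp (x - z)). replace (- (x - z))%C with ((y - x) + (z - y))%C by ring.
    apply Cmod_triangle. }
  pose proof (HB x y Hx Hy ltac:(lra)) as B1.
  pose proof (HB y z Hy Hz ltac:(lra)) as B2.
  pose proof (HB z x Hz Hx ltac:(lra)) as B3.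
  pose proof (tri_affine (f l) m l x y z) as TA. fold A in TA. unfold tri in TA, Htri.
  replace (lint f x y + lint f y z + lint f z x)%C
    with ((lint f x y - lint A x y) + (lint f y z - lint A y z) + (lint f z x - lint A z x))%C
    in Htri.
  2:{ transitivity (lint f x y + lint f y z + lint f z x - (lint A x y + lint A y z + lint A z x))%C; [ring|].
      rewrite TA. ring. }
  assert (HX : T / 4 ^ n <= (Cmod (y - x) + Cmod (z - y) + Cmod (x - z)) * (eps * (3 * D))).
  { eapply Rle_trans; [exact Htri|]. eapply Rle_trans; [apply Cmod_triangle|].
    pose proof (Cmod_triangle (lint f x y - lint A x y) (lint f y z - lint A y z)). lra. }
  assert (HD : 0 < D) by (apply Rdiv_lt_0_compat; lra).
  assert (HX2 : T / 4 ^ n <= D * (eps * (3 * D))).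
  { eapply Rle_trans; [exact HX|]. apply Rmult_le_compat_r; [|easy]. nra. }
  assert (E4 : 4 ^ n = 2 ^ n * 2 ^ n) by (rewrite <- Rpow_mult_distr; f_equal; lra).
  replace (D * (eps * (3 * D))) with (3 / 4 * (T / 4 ^ n)) in HX2.
  2:{ unfold D, eps. rewrite E4. field. lra. }
  assert (0 < T / 4 ^ n) by (apply Rdiv_lt_0_compat; [easy|apply pow_lt; lra]).
  lra.
Qed.

Lemma cball_closed (a : C) (r : R) : seq_closed (cball a r).
Proof.
intros l Hl. apply le_epsilon. intros eps Heps. destruct (Hl eps Heps) as (x & Hx & Hd).
unfold cball in Hx. replace (l - a)%C with ((l - x) + (x - a))%C by ring.
eapply Rle_trans; [apply Cmod_triangle|]. lra.
Qed.

Lemma half_plane_convex (s : R) : convex (fun z => fst z <= s).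
Proof.
intros [u1 u2] [v1 v2] t Hu Hv Ht. unfold seg. simpl in *. nra.
Qed.

Lemma half_plane_closed (s : R) : seq_closed (fun z => fst z <= s).
Proof.
intros l Hl. apply le_epsilon. intros eps Heps. destruct (Hl eps Heps) as (x & Hx & Hd).
pose proof (Rle_trans _ _ _ (Rle_abs _) (fst_le_Cmod (l - x))) as H. simpl in H. lra.
Qed.

(** The primitive is the integral from the centre; Goursat's theorem identifies its increments with
    integrals over short segments. *)
Lemma primitive_exists (a : C) (r : R) (f : C -> C) :
  0 < r -> differentiable_on (oball a r) f ->
  exists F : C -> C, F a = 0 /\ forall z, oball a r z -> is_cderive F z (f z).
Proof.
intros Hr Hf. exists (fun z => lint f a z). split.
{ unfold lint. ring. }
intros z Hz. apply is_cderive_eps. intros eps Heps.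
destruct (Hf z Hz) as [l Hl].
destruct (Ccont_derive _ _ _ Hl eps Heps) as (d & Hd & Hw).
unfold oball in Hz. set (r' := (Cmod (z - a) + r) / 2).
assert (Hf' : differentiable_on (cball a r') f).
{ intros w Hw'. apply Hf. unfold cball, oball, r' in *. lra. }
exists (Rmin d (r' - Cmod (z - a))); split; [apply Rmin_pos; unfold r'; lra|].
intros w Hwz.
assert (H1 := Rlt_le_trans _ _ _ Hwz (Rmin_l _ _)).
assert (H2 := Rlt_le_trans _ _ _ Hwz (Rmin_r _ _)).
assert (Ha : cball a r' a).
{ unfold cball. replace (a - a)%C with (RtoC 0) by ring. rewrite Cmod_0.
  pose proof (Cmod_ge_0 (z - a)). unfold r'. lra. }
assert (Hz' : cball a r' z) by (unfold cball, r'; lra).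
assert (Hw' : cball a r' w).
{ unfold cball. replace (w - a)%C with ((w - z) + (z - a))%C by ring.
  eapply Rle_trans; [apply Cmod_triangle|]. lra. }
assert (Hcs : forall u v, cball a r' u -> cball a r' v -> cont_seg f u v).
{ intros u v Hu Hv. exact (cont_seg_differentiable _ f u v (cball_convex a r') Hf' Hu Hv). }
pose proof (goursat _ f a z w (cball_convex a r') (cball_closed a r') Hf' Ha Hz' Hw') as G.
unfold tri in G. rewrite (lint_rev f a w) in G by auto.
replace (lint f a w - lint f a z - f z * (w - z))%C with (lint f z w - lint (fun _ => f z) z w)%C.
2:{ rewrite lint_const.
    replace (lint f z w) with (lint f a z + lint f z w + - lint f a w + (lint f a w - lint f a z))%C by ring.
    rewrite G. ring. }
assert (Hcc : cont_seg (fun _ => f z) z w) by (intros t _; exact (Ccont_derive _ _ _ (is_cderive_const (f z) _))).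
rewrite <- lint_minus by auto. rewrite Rmult_comm. apply lint_bound.
- intros t Ht. destruct (Hf' _ (cball_convex a r' z w t Hz' Hw' Ht)) as [l1 Hl1].
  exact (Ccont_derive _ _ _ (is_cderive_minus _ _ _ _ _ Hl1 (is_cderive_const (f z) _))).
- intros t Ht. left. apply Hw. eapply Rle_lt_trans; [apply Cmod_seg, Ht|easy].
Qed.

(** * The derivative as an average of difference quotients *)

Definition circ (r t : R) : C := (RtoC r * Cexp (0%R, (2 * PI * t)%R))%C.

Lemma Cmod_circ (r t : R) : 0 < r -> Cmod (circ r t) = r.
Proof.
intros Hr. unfold circ. rewrite Cmod_mult, Cmod_Cexp, Cmod_R, Rabs_right by lra.
simpl. rewrite exp_0. ring.
Qed.

Lemma circ_neq_0 (r t : R) : 0 < r -> circ r t <> 0.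
Proof. intros Hr. apply Cmod_gt_0. now rewrite Cmod_circ. Qed.

Definition period : C := (0%R, (2 * PI)%R).

Lemma Cexp_period (z : C) : Cexp (z + period) = Cexp z.
Proof.
rewrite Cexp_plus. replace (Cexp period) with (RtoC 1); [ring|].
unfold Cexp, period; simpl. rewrite exp_0, cos_2PI, sin_2PI. unfold RtoC; f_equal; ring.
Qed.

Lemma Cmod_period : 0 < Cmod period.
Proof.
apply Cmod_gt_0. intros E. apply (f_equal snd) in E. simpl in E. pose proof PI_RGT_0. lra.
Qed.

(** Goursat's theorem on the two halves of the parallelogram with vertices [z0], [z0 + period],
    [z1 + period], [z1]: the sides joining [z0] to [z1] and their translates cancel by periodicity. *)
Lemma lint_periodic (k : C -> C) (U : C -> Prop) (z0 z1 : C) :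
  convex U -> seq_closed U -> differentiable_on U k ->
  (forall z, k (z + period)%C = k z) ->
  U z0 -> U (z0 + period)%C -> U z1 -> U (z1 + period)%C ->
  lint k z0 (z0 + period) = lint k z1 (z1 + period).
Proof.
intros HU HU' Hk Hp H0 H0' H1 H1'.
assert (Hcs : forall u v, U u -> U v -> cont_seg k u v).
{ intros u v Hu Hv. exact (cont_seg_differentiable _ k u v HU Hk Hu Hv). }
pose proof (goursat U k _ _ _ HU HU' Hk H0 H0' H1') as G1.
pose proof (goursat U k _ _ _ HU HU' Hk H0 H1' H1) as G2.
unfold tri in G1, G2.
rewrite (lint_rev k z0 (z1 + period)) in G1 by auto.
rewrite (lint_rev k z1 (z1 + period)), (lint_rev k z0 z1) in G2 by auto.
assert (E : lint k (z0 + period) (z1 + period) = lint k z0 z1).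
{ unfold lint. replace (z1 + period - (z0 + period))%C with (z1 - z0)%C by ring.
  f_equal. apply (RInt_ext (V := C_R_CompleteNormedModule)). intros t _.
  symmetry. rewrite <- Hp. f_equal. unfold seg. ring. }
rewrite E in G1.
transitivity (lint k z1 (z1 + period) + (lint k z0 (z0 + period) + lint k z0 z1 + - lint k z0 (z1 + period)) +
  (lint k z0 (z1 + period) + - lint k z1 (z1 + period) + - lint k z0 z1))%C; [ring|].
rewrite G1, G2. ring.
Qed.

Lemma eq_of_Cmod_small (z w : C) : (forall eps, 0 < eps -> Cmod (z - w) <= eps) -> z = w.
Proof.
intros H. apply Ceq_minus, Cmod_eq_0, Rle_antisym; [|apply Cmod_ge_0].
apply le_epsilon. intros eps Heps. rewrite Rplus_0_l. now apply H.
Qed.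

Lemma seg_period (z : C) (t : R) : seg z (z + period) t = (z + (0%R, (2 * PI * t)%R))%C.
Proof.
unfold seg, period. destruct z. unfold Cplus, Cminus, Copp, Cmult; simpl. f_equal; ring.
Qed.

(** In the coordinate [zeta] with [z = a + exp zeta], the circle of radius [r] around [a] is the
    vertical segment of length [2 PI] that starts here. *)
Definition log_radius (r : R) : C := (ln r, 0%R).

Lemma Cexp_log_radius (r t : R) : 0 < r ->
  Cexp (seg (log_radius r) (log_radius r + period) t) = circ r t.
Proof.
intros Hr. rewrite seg_period, Cexp_plus. unfold circ. f_equal. unfold log_radius, Cexp; simpl.
rewrite exp_ln, cos_0, sin_0 by easy. unfold RtoC; f_equal; ring.
Qed.

(** The difference quotient of [f] at [a], in the coordinate [z] whose exponential is the
    increment. *)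
Definition exp_quotient (f : C -> C) (a z : C) : C :=
  ((f (a + Cexp z) - f a) * Cexp (- z))%C.

Lemma exp_quotient_circle (f : C -> C) (a : C) (r t : R) : 0 < r ->
  exp_quotient f a (seg (log_radius r) (log_radius r + period) t)
  = ((f (a + circ r t) - f a) / circ r t)%C.
Proof.
intros Hr. unfold exp_quotient, Cdiv. set (z := seg _ _ t).
assert (Ec : Cexp z = circ r t) by now apply Cexp_log_radius.
rewrite Ec. f_equal. pose proof (Cexp_opp_mult z) as E. rewrite Ec in E.
pose proof (circ_neq_0 r t Hr) as Hne.
transitivity (/ circ r t * (circ r t * Cexp (- z)))%C; [now field|]. rewrite E. ring.
Qed.

(** The difference quotient in the exponential coordinate is periodic and holomorphic on a half
    plane, so its integral over a vertical period is the same at [ln r] and arbitrarily far to the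
    left, where the quotient tends uniformly to [l]. *)
Lemma derivative_circle (f : C -> C) (a l : C) (r : R) :
  0 < r -> differentiable_on (cball a r) f -> is_cderive f a l ->
  is_Cint (fun t => ((f (a + circ r t) - f a) / circ r t)%C) l.
Proof.
intros Hr Hf Hl.
pose (k := exp_quotient f a).
pose (U := fun z : C => fst z <= ln r).
assert (Hk : differentiable_on U k).
{ intros z Hz. destruct (Hf (a + Cexp z)%C) as [m Hm].
  { unfold cball. replace (a + Cexp z - a)%C with (Cexp z) by ring. rewrite Cmod_Cexp.
    rewrite <- (exp_ln r Hr). destruct Hz as [Hz|Hz]; [left; now apply exp_increasing|right; now f_equal]. }
  eexists. apply (is_cderive_mult (fun z => f (a + Cexp z) - f a)%C (fun z => Cexp (- z))).
  - apply is_cderive_minus; [|apply is_cderive_const].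
    apply (is_cderive_comp f (fun z => a + Cexp z)%C); [exact Hm|].
    apply (is_cderive_plus (fun _ => a)); [apply is_cderive_const|apply is_cderive_Cexp].
  - apply is_cderive_Cexp_opp. }
assert (Hp : forall z, k (z + period)%C = k z).
{ intros z. unfold k, exp_quotient. rewrite Cexp_period. f_equal.
  replace (- z)%C with (- (z + period) + period)%C by ring. symmetry. apply Cexp_period. }
assert (HUp : forall z, U z -> U (z + period)%C).
{ intros z Hz. unfold U in *. simpl. lra. }
pose (z0 := log_radius r).
assert (Hz0 : U z0) by (unfold U, z0, log_radius; simpl; lra).
assert (Hcs : forall u v, U u -> U v -> cont_seg k u v).
{ intros u v Hu Hv. exact (cont_seg_differentiable _ k u v (half_plane_convex _) Hk Hu Hv). }
assert (E : lint k z0 (z0 + period) = (period * l)%C).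
{ apply eq_of_Cmod_small. intros eps Heps. pose proof Cmod_period as HP.
  assert (He : 0 < eps / Cmod period) by now apply Rdiv_lt_0_compat.
  destruct (proj1 (is_cderive_eps _ _ _) Hl _ He) as (d & Hd & Hw).
  pose (z1 := log_radius (Rmin r (d / 2))).
  assert (Hm : 0 < Rmin r (d / 2)) by (apply Rmin_pos; lra).
  assert (Hz1 : U z1).
  { unfold U, z1, log_radius; simpl. apply ln_le; [easy|apply Rmin_l]. }
  rewrite (lint_periodic k U z0 z1 (half_plane_convex _) (half_plane_closed _)) by auto.
  replace (period * l)%C with (lint (fun _ => l) z1 (z1 + period)) by (rewrite lint_const; ring).
  assert (Hcc : cont_seg (fun _ => l) z1 (z1 + period))
    by (intros t _; exact (Ccont_derive _ _ _ (is_cderive_const l _))).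
  rewrite <- lint_minus by auto.
  replace eps with (Cmod (z1 + period - z1) * (eps / Cmod period)).
  2:{ replace (z1 + period - z1)%C with period by ring. field. lra. }
  apply lint_bound.
  - intros t Ht. destruct (Hk (seg z1 (z1 + period) t)) as [l1 Hl1].
    { exact (half_plane_convex (ln r) _ _ t Hz1 (HUp _ Hz1) Ht). }
    exact (Ccont_derive _ _ _ (is_cderive_minus _ _ _ _ _ Hl1 (is_cderive_const l _))).
  - intros t Ht. set (z := seg z1 (z1 + period) t).
    assert (Hz : Cmod (Cexp z) = Rmin r (d / 2)).
    { unfold z, z1. rewrite Cexp_log_radius by easy. now apply Cmod_circ. }
    assert (Hz2 : 0 < Cmod (Cexp z)) by lra.
    assert (Hzd : Cmod (Cexp z) < d) by (rewrite Hz; pose proof (Rmin_r r (d / 2)); lra).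
    specialize (Hw (a + Cexp z)%C). replace (a + Cexp z - a)%C with (Cexp z) in Hw by ring.
    specialize (Hw Hzd).
    replace (k z - l)%C with ((f (a + Cexp z) - f a - l * Cexp z) * Cexp (- z))%C.
    2:{ unfold k, exp_quotient. transitivity ((f (a + Cexp z) - f a) * Cexp (- z) - l * (Cexp z * Cexp (- z)))%C; [ring|].
        rewrite Cexp_opp_mult. ring. }
    rewrite Cmod_mult.
    pose proof (f_equal Cmod (Cexp_opp_mult z)) as E. rewrite Cmod_mult, Cmod_1 in E.
    pose proof (Cmod_ge_0 (Cexp (- z))).
    apply (Rmult_le_compat_r (Cmod (Cexp (- z)))) in Hw; [|easy].
    rewrite Rmult_assoc, E in Hw. lra. }
assert (EI : Cint (fun t => k (seg z0 (z0 + period) t)) = l).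
{ unfold lint in E. replace (z0 + period - z0)%C with period in E by ring.
  set (X := Cint _) in *.
  assert (E' : (period * (X - l))%C = 0) by (transitivity (period * X - period * l)%C; [ring|rewrite E; ring]).
  destruct (Ceq_dec X l) as [|N]; [easy|]. exfalso. revert E'. apply Cmult_neq_0.
  - apply Cmod_gt_0, Cmod_period.
  - now apply Cminus_eq_contra. }
rewrite <- EI. eapply is_RInt_ext; [|apply (is_Cint_seg k z0 (z0 + period)); auto].
intros t _. now apply exp_quotient_circle.
Qed.

Lemma cauchy_estimate (f : C -> C) (a l : C) (r M : R) :
  0 < r -> differentiable_on (cball a r) f -> is_cderive f a l ->
  (forall z, Cmod (z - a) = r -> Cmod (f z - f a) <= M) -> Cmod l <= M / r.
Proof.
intros Hr Hf Hl HM. apply (is_Cint_bound _ _ _ (derivative_circle f a l r Hr Hf Hl)).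
intros t _. rewrite Cmod_div by now apply circ_neq_0. rewrite Cmod_circ by easy.
apply Rmult_le_compat_r; [left; now apply Rinv_0_lt_compat|].
apply HM. replace (a + circ r t - a)%C with (circ r t) by ring. now apply Cmod_circ.
Qed.

(** * Regularity of the derivative *)

Lemma Ccont_lipschitz (f : C -> C) (z : C) (d K : R) : 0 < d ->
  (forall w, Cmod (w - z) < d -> Cmod (f w - f z) <= K * Cmod (w - z)) -> Ccont f z.
Proof.
intros Hd H eps Heps.
assert (HK : 0 < 1 + Rabs K) by (pose proof (Rabs_pos K); lra).
exists (Rmin d (eps / (1 + Rabs K))); split.
{ apply Rmin_pos; [easy|]. now apply Rdiv_lt_0_compat. }
intros w Hw.
assert (H1 := Rlt_le_trans _ _ _ Hw (Rmin_l _ _)).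
assert (H2 := Rlt_le_trans _ _ _ Hw (Rmin_r _ _)).
eapply Rle_lt_trans; [apply H, H1|]. apply Rlt_div_r in H2; [|easy].
pose proof (Rle_abs K). pose proof (Cmod_ge_0 (w - z)). nra.
Qed.

Lemma Ccont_comp (f g : C -> C) (z : C) :
  Ccont f (g z) -> Ccont g z -> Ccont (fun w => f (g w)) z.
Proof.
intros Hf Hg eps Heps. destruct (Hf eps Heps) as (d & Hd & Hw).
destruct (Hg d Hd) as (d' & Hd' & Hw'). exists d'; split; [easy|].
intros w H. now apply Hw, Hw'.
Qed.

Lemma Ccont_mult (f g : C -> C) (z : C) :
  Ccont f z -> Ccont g z -> Ccont (fun w => f w * g w)%C z.
Proof.
intros Hf Hg eps Heps.
pose proof (Cmod_ge_0 (f z)) as Pf. pose proof (Cmod_ge_0 (g z)) as Pg.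
destruct (Hf (eps / (2 * (1 + Cmod (g z))))) as (d1 & Hd1 & H1).
{ apply Rdiv_lt_0_compat; lra. }
destruct (Hf 1 Rlt_0_1) as (d2 & Hd2 & H2).
destruct (Hg (eps / (2 * (1 + Cmod (f z))))) as (d3 & Hd3 & H3).
{ apply Rdiv_lt_0_compat; lra. }
exists (Rmin d1 (Rmin d2 d3)); split; [repeat apply Rmin_pos; easy|].
intros w Hw.
assert (A1 := Rlt_le_trans _ _ _ Hw (Rmin_l _ _)).
assert (A := Rlt_le_trans _ _ _ Hw (Rmin_r _ _)).
assert (A2 := Rlt_le_trans _ _ _ A (Rmin_l _ _)).
assert (A3 := Rlt_le_trans _ _ _ A (Rmin_r _ _)).
specialize (H1 w A1). specialize (H2 w A2). specialize (H3 w A3).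
apply Rlt_div_r in H1; [|lra]. apply Rlt_div_r in H3; [|lra].
replace (f w * g w - f z * g z)%C with ((f w - f z) * g z + ((f w - f z) + f z) * (g w - g z))%C by ring.
eapply Rle_lt_trans; [apply Cmod_triangle|]. rewrite !Cmod_mult.
pose proof (Cmod_triangle (f w - f z) (f z)).
pose proof (Cmod_ge_0 (g w - g z)). pose proof (Cmod_ge_0 (f w - f z)). nra.
Qed.

Lemma Cmod_sub_triangle (a b c : C) : Cmod (a - c) <= Cmod (a - b) + Cmod (b - c).
Proof. replace (a - c)%C with ((a - b) + (b - c))%C by ring. apply Cmod_triangle. Qed.

Lemma Cmod_sub_sym (a b : C) : Cmod (a - b) = Cmod (b - a).
Proof. rewrite <- Cmod_opp. f_equal. ring. Qed.

(** Continuity bounds [f] near [a], Cauchy's estimate then bounds [df], so [f] is Lipschitz; averaging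
    differences of difference quotients over a circle transfers this to [df]. *)
Lemma derivative_lipschitz (f df : C -> C) (a : C) (r : R) :
  0 < r -> (forall z, oball a r z -> is_cderive f z (df z)) ->
  exists R K, 0 < R /\ 0 < K /\ 3 * R < r /\
   forall z w, cball a (2 * R) z -> cball a (2 * R) w -> Cmod (df w - df z) <= K * Cmod (w - z).
Proof.
intros Hr Hdf.
assert (Haa : oball a r a).
{ unfold oball. replace (a - a)%C with (RtoC 0) by ring. now rewrite Cmod_0. }
destruct (Ccont_derive _ _ _ (Hdf a Haa) 1 Rlt_0_1) as (d & Hd & Hfd).
(* On the ball of radius 4 R0 around a, f stays within 1 of f a. *)
set (R0 := Rmin r d / 5). pose proof (Rmin_l r d). pose proof (Rmin_r r d).
assert (Hm : 0 < Rmin r d) by now apply Rmin_pos.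
assert (H4r : 4 * R0 < r) by (unfold R0; lra). assert (H4d : 4 * R0 < d) by (unfold R0; lra).
assert (HR : 0 < R0) by (unfold R0; lra).
assert (Hdiff : forall z s, Cmod (z - a) + s <= 4 * R0 -> differentiable_on (cball z s) f).
{ intros z s Hs w Hw. exists (df w). apply Hdf. unfold cball, oball in *.
  pose proof (Cmod_sub_triangle w z a). lra. }
assert (Hb : forall z, cball a (3 * R0) z -> Cmod (df z) <= 2 / R0).
{ intros z Hz. unfold cball in Hz.
  apply (cauchy_estimate f z); [easy|apply Hdiff; lra|apply Hdf; unfold oball; lra|].
  intros w Hw. pose proof (Cmod_sub_triangle w z a).
  pose proof (Hfd w ltac:(lra)). pose proof (Hfd z ltac:(lra)) as Hz'.
  rewrite Cmod_sub_sym in Hz'. pose proof (Cmod_sub_triangle (f w) (f a) (f z)). lra. }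
assert (HL : forall z w, cball a (3 * R0) z -> cball a (3 * R0) w ->
  Cmod (f w - f z) <= 2 / R0 * Cmod (w - z)).
{ intros z w. apply (mean_value_le_convex _ f df _ z w (cball_convex a (3 * R0))).
  - intros x Hx. apply Hdf. unfold cball, oball in *. lra.
  - easy. }
exists R0, (4 / R0 / R0). repeat split; [easy| |lra|].
{ repeat apply Rdiv_lt_0_compat; lra. }
intros z w Hz Hw. unfold cball in *.
assert (Hcirc : forall x, Cmod (x - a) <= 2 * R0 ->
  is_Cint (fun t => ((f (x + circ R0 t) - f x) / circ R0 t)%C) (df x)).
{ intros x Hx. apply derivative_circle; [easy|apply Hdiff; lra|apply Hdf; unfold oball; lra]. }
pose proof (is_Cint_plus _ _ _ _ (Hcirc w Hw) (is_Cint_mult _ (- (1)) _ (Hcirc z Hz))) as HI.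
replace (df w - df z)%C with (df w + - (1) * df z)%C by ring.
apply (is_Cint_bound _ _ _ HI). intros t _. cbv beta.
pose proof (circ_neq_0 R0 t HR) as Hc0. pose proof (Cmod_circ R0 t HR) as Hc.
set (c := circ R0 t) in *.
replace ((f (w + c) - f w) / c + - (1) * ((f (z + c) - f z) / c))%C
  with (((f (w + c) - f (z + c)) + - (f w - f z)) / c)%C by now field.
rewrite Cmod_div by easy. rewrite Hc. unfold Rdiv at 1.
replace (4 / R0 / R0 * Cmod (w - z)) with ((4 / R0 * Cmod (w - z)) * / R0) by (field; lra).
apply Rmult_le_compat_r; [left; now apply Rinv_0_lt_compat|].
eapply Rle_trans; [apply Cmod_triangle|]. rewrite Cmod_opp.
assert (H3 : forall x, Cmod (x - a) <= 2 * R0 -> Cmod (x + c - a) <= 3 * R0).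
{ intros x Hx. replace (x + c - a)%C with ((x - a) + c)%C by ring.
  eapply Rle_trans; [apply Cmod_triangle|]. lra. }
pose proof (HL (z + c)%C (w + c)%C (H3 z Hz) (H3 w Hw)) as L1.
replace (w + c - (z + c))%C with (w - z)%C in L1 by ring.
pose proof (HL z w ltac:(unfold cball; lra) ltac:(unfold cball; lra)) as L2.
replace (4 / R0 * Cmod (w - z)) with (2 / R0 * Cmod (w - z) + 2 / R0 * Cmod (w - z)) by (field; lra).
lra.
Qed.

(** Since [df] is Lipschitz, [f (z + h) - f z - df z h] is at most [K |h|^2] uniformly in [z]; averaging
    over a circle the formula for the derivative at [a] and at [w] gives the same order of error
    for [df]. *)
Lemma derivative_differentiable_at (f df : C -> C) (a : C) (r : R) :
  0 < r -> (forall z, oball a r z -> is_cderive f z (df z)) -> exists l, is_cderive df a l.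
Proof.
intros Hr Hdf.
destruct (derivative_lipschitz f df a r Hr Hdf) as (R0 & K & HR & HK & HRr & HL).
assert (HT : forall z w, cball a (2 * R0) z -> cball a (2 * R0) w ->
  Cmod (f w - f z - df z * (w - z)) <= K * Cmod (w - z) * Cmod (w - z)).
{ intros z w Hz Hw.
  apply (linear_approximation (fun x => cball a (2 * R0) x /\ cball z (Cmod (w - z)) x) f df (df z)).
  - intros u v t [Hu1 Hu2] [Hv1 Hv2] Ht. split; now apply cball_convex.
  - intros x [Hx _]. apply Hdf. unfold cball, oball in *. lra.
  - split; [easy|]. unfold cball. replace (z - z)%C with (RtoC 0) by ring. rewrite Cmod_0. apply Cmod_ge_0.
  - split; [easy|]. unfold cball. lra.
  - intros x [Hx Hx']. eapply Rle_trans; [now apply HL|]. apply Rmult_le_compat_l; [lra|exact Hx']. }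
pose (k := exp_quotient df a).
pose (z0 := log_radius R0).
assert (Hcs : cont_seg k z0 (z0 + period)).
{ intros t Ht. set (z := seg z0 (z0 + period) t).
  assert (Hz : Cexp z = circ R0 t) by now apply Cexp_log_radius.
  apply (Ccont_mult (fun z => df (a + Cexp z) - df a)%C (fun z => Cexp (- z))).
  - apply (Ccont_comp (fun u => df u - df a)%C (fun z => a + Cexp z)%C).
    + apply Ccont_lipschitz with R0 K; [easy|]. intros w Hw.
      replace (df w - df a - (df (a + Cexp z) - df a))%C with (df w - df (a + Cexp z))%C by ring.
      assert (Hza : Cmod (a + Cexp z - a) = R0).
      { replace (a + Cexp z - a)%C with (Cexp z) by ring. rewrite Hz. now apply Cmod_circ. }
      apply HL; unfold cball; [lra|].
      pose proof (Cmod_sub_triangle w (a + Cexp z) a). lra.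
    + apply (Ccont_derive _ _ (0 + Cexp z)%C).
      apply (is_cderive_plus (fun _ => a)); [apply is_cderive_const|apply is_cderive_Cexp].
  - exact (Ccont_derive _ _ _ (is_cderive_Cexp_opp z)). }
(* The derivative of df at a is the average of its difference quotients over a circle. *)
pose proof (is_Cint_seg k z0 (z0 + period) Hcs) as HI.
set (l := Cint _) in HI. exists l. apply is_cderive_eps. intros eps Heps.
assert (Hd : 0 < eps * R0 / (2 * K)) by (apply Rdiv_lt_0_compat; nra).
exists (Rmin R0 (eps * R0 / (2 * K))); split; [now apply Rmin_pos|].
intros w Hwa.
assert (H1 := Rlt_le_trans _ _ _ Hwa (Rmin_l _ _)).
assert (H2 := Rlt_le_trans _ _ _ Hwa (Rmin_r _ _)). clear Hwa.
assert (Hcirc : forall x, Cmod (x - a) <= R0 ->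
  is_Cint (fun t => ((f (x + circ R0 t) - f x) / circ R0 t)%C) (df x)).
{ intros x Hx. apply derivative_circle; [easy| |apply Hdf; unfold oball; lra].
  intros u Hu. exists (df u). apply Hdf. unfold cball, oball in *.
  pose proof (Cmod_sub_triangle u x a). lra. }
assert (Haa : Cmod (a - a) = 0) by (replace (a - a)%C with (RtoC 0) by ring; apply Cmod_0).
pose proof (is_Cint_plus _ _ _ _
  (is_Cint_plus _ _ _ _ (Hcirc w ltac:(lra)) (is_Cint_mult _ (- (1)) _ (Hcirc a ltac:(lra))))
  (is_Cint_mult _ (- (w - a))%C _ HI)) as HJ.
replace (df w - df a - l * (w - a))%C with (df w + - (1) * df a + - (w - a) * l)%C by ring.
assert (HB : Cmod (df w + - (1) * df a + - (w - a) * l) <= 2 * K * Cmod (w - a) * Cmod (w - a) / R0).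
{ apply (is_Cint_bound _ _ _ HJ). intros t _. cbv beta.
  unfold k, z0. rewrite exp_quotient_circle by easy.
  pose proof (circ_neq_0 R0 t HR) as Hc0. pose proof (Cmod_circ R0 t HR) as Hc.
  set (c := circ R0 t) in *.
  replace (_ + _)%C with (((f (w + c) - f (a + c) - df (a + c) * (w + c - (a + c)))
     + - (f w - f a - df a * (w - a))) / c)%C by now field.
  rewrite Cmod_div by easy. rewrite Hc.
  apply Rmult_le_compat_r; [left; now apply Rinv_0_lt_compat|].
  eapply Rle_trans; [apply Cmod_triangle|]. rewrite Cmod_opp.
  assert (Hca : Cmod (a + c - a) = R0) by (replace (a + c - a)%C with c by ring; easy).
  assert (Hwc : Cmod (w + c - (a + c)) = Cmod (w - a)) by (f_equal; ring).
  pose proof (Cmod_sub_triangle (w + c) (a + c) a).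
  pose proof (HT (a + c)%C (w + c)%C ltac:(unfold cball; lra) ltac:(unfold cball; lra)) as T1.
  pose proof (HT a w ltac:(unfold cball; lra) ltac:(unfold cball; lra)) as T2.
  rewrite Hwc in T1. lra. }
eapply Rle_trans; [exact HB|].
replace (2 * K * Cmod (w - a) * Cmod (w - a) / R0)
  with ((Cmod (w - a) * (2 * K)) / R0 * Cmod (w - a)) by (field; lra).
apply Rmult_le_compat_r; [apply Cmod_ge_0|].
apply Rlt_div_r in H2; [|lra]. apply Rle_div_l; lra.
Qed.

Lemma derivative_differentiable_on (a : C) (r : R) (f df : C -> C) :
  (forall z, oball a r z -> is_cderive f z (df z)) -> differentiable_on (oball a r) df.
Proof.
intros Hdf z Hz. unfold oball in Hz.
apply (derivative_differentiable_at f df z (r - Cmod (z - a))); [lra|].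
intros w Hw. apply Hdf. unfold oball in *. pose proof (Cmod_sub_triangle w z a). lra.
Qed.

Lemma derivative_function (U : C -> Prop) (f : C -> C) : differentiable_on U f ->
  exists df : C -> C, forall z, U z -> is_cderive f z (df z).
Proof.
intros Hf. exists (fun z => epsilon (inhabits (RtoC 0)) (fun l => is_cderive f z l)).
intros z Hz. apply epsilon_spec. now apply Hf.
Qed.

Lemma is_cderive_ext_loc (f g : C -> C) (a l : C) (r : R) : 0 < r ->
  (forall z, oball a r z -> f z = g z) -> is_cderive f a l -> is_cderive g a l.
Proof.
intros Hr E Hf. apply is_cderive_eps. intros eps Heps.
destruct (proj1 (is_cderive_eps _ _ _) Hf eps Heps) as (d & Hd & Hw).
exists (Rmin r d); split; [now apply Rmin_pos|]. intros w H.
rewrite <- (E a) by now apply oball_center.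
rewrite <- (E w) by exact (Rlt_le_trans _ _ _ H (Rmin_l _ _)).
apply Hw. exact (Rlt_le_trans _ _ _ H (Rmin_r _ _)).
Qed.

(** * Logarithms *)

(** A logarithm is a primitive of [f' / f], which is holomorphic because [f'] is. *)
Lemma holomorphic_log (a : C) (r : R) (f : C -> C) (L0 : C) :
  0 < r -> differentiable_on (oball a r) f -> (forall z, oball a r z -> f z <> 0) ->
  Cexp L0 = f a ->
  exists g : C -> C, g a = L0 /\ (forall z, oball a r z -> Cexp (g z) = f z) /\
    differentiable_on (oball a r) g.
Proof.
intros Hr Hf Hf0 HL.
destruct (derivative_function _ f Hf) as [df Hdf].
destruct (primitive_exists a r (fun z => df z * / f z)%C Hr) as (F & HF0 & HF).
{ intros z Hz. destruct (derivative_differentiable_on a r f df Hdf z Hz) as [l Hl].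
  eexists. apply (is_cderive_mult df); [exact Hl|]. apply is_cderive_inv; [now apply Hdf|now apply Hf0]. }
assert (Hg : forall z, oball a r z -> is_cderive (fun z => L0 + F z)%C z (df z * / f z)%C).
{ intros z Hz. eapply is_cderive_ext; [reflexivity| |
    apply (is_cderive_plus (fun _ => L0) F); [apply is_cderive_const|now apply HF]]. ring. }
exists (fun z => L0 + F z)%C. split; [|split].
- rewrite HF0. ring.
(* The quotient of f by exp g has derivative 0. *)
- pose (h := fun z => (Cexp (- (L0 + F z)) * f z)%C).
  assert (Hh : forall z, oball a r z -> is_cderive h z (RtoC 0)).
  { intros z Hz. unfold h.
    eapply is_cderive_ext with (f := fun z => (Cexp (- (1) * (L0 + F z)) * f z)%C); [| |
      apply (is_cderive_mult (fun z => Cexp (- (1) * (L0 + F z)))%C f); [|now apply Hdf];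
      apply (is_cderive_comp Cexp (fun z => - (1) * (L0 + F z))%C); [apply is_cderive_Cexp|];
      apply (is_cderive_scal (- (1)) (fun z => L0 + F z)%C), Hg, Hz].
    + intros x. f_equal. f_equal. ring.
    + cbv beta. field. now apply Hf0. }
  assert (Hha : h a = 1).
  { unfold h. rewrite HF0, <- HL, Cmult_comm. replace (- (L0 + 0))%C with (- L0)%C by ring. apply Cexp_opp_mult. }
  intros z Hz.
  assert (E : h z = 1).
  { apply Ceq_minus, Cmod_eq_0, Rle_antisym; [|apply Cmod_ge_0].
    rewrite <- Hha.
    pose proof (mean_value_le_convex _ h (fun _ => 0) 0 a z (oball_convex a r) Hh) as K.
    rewrite Rmult_0_l in K. apply K; [intros; rewrite Cmod_0; lra|now apply oball_center|easy]. }
  unfold h in E.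
  transitivity (Cexp (L0 + F z) * (Cexp (- (L0 + F z)) * f z))%C; [rewrite E; ring|].
  rewrite Cmult_assoc, Cexp_opp_mult. ring.
- intros z Hz. eexists. now apply Hg.
Qed.

(** The bound on the argument matters for Landau's estimate, where the logarithm of [- f 0] has to be
    controlled by [ln |f 0|]. *)
Lemma complex_log (w : C) : w <> 0 ->
  exists L0, Cexp L0 = w /\ fst L0 = ln (Cmod w) /\ Rabs (snd L0) <= PI.
Proof.
intros Hw. pose proof (proj1 (Cmod_gt_0 w) Hw) as Hr.
destruct w as [x y]. set (r := Cmod (x, y)) in *.
assert (Hr2 : r * r = x * x + y * y).
{ transitivity (r ^ 2); [ring|]. unfold r. rewrite Cmod2_alt. simpl. ring. }
set (u := x / r).
assert (Hu : -1 <= u <= 1).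
{ pose proof (fst_le_Cmod (x, y)) as H. simpl in H. fold r in H. apply Rabs_le_between in H.
  unfold u. split; [apply Rle_div_r; lra|apply Rle_div_l; lra]. }
assert (Hs : sqrt (1 - u²) = Rabs y / r).
{ apply sqrt_lem_1.
  - unfold Rsqr. nra.
  - apply Rdiv_le_0_compat; [apply Rabs_pos|easy].
  - unfold u, Rsqr. replace (Rabs y / r * (Rabs y / r)) with ((Rabs y * Rabs y) / (r * r)) by (field; lra).
    rewrite <- Rabs_mult, Rabs_right by (apply Rle_ge, Rle_0_sqr).
    replace (y * y) with (r * r - x * x) by lra. field. lra. }
pose proof (acos_bound u) as Hb.
destruct (Rle_dec 0 y) as [Hy|Hy].
- exists (ln r, acos u). repeat split.
  + unfold Cexp; simpl. rewrite exp_ln, cos_acos, sin_acos, Hs, Rabs_right by lra.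
    unfold u; f_equal; field; lra.
  + simpl. apply Rabs_le; lra.
- exists (ln r, (- acos u)%R). repeat split.
  + unfold Cexp; simpl. rewrite cos_neg, sin_neg, exp_ln, cos_acos, sin_acos, Hs, Rabs_left by lra.
    unfold u; f_equal; field; lra.
  + simpl. rewrite Rabs_Ropp. apply Rabs_le; lra.
Qed.

(** * Bloch's theorem *)

(** A substitute for maximising [|g z| (1 - |z|)]: it needs only continuity of [g], and no bound
    for [g] on a compact set. *)
Lemma point_selection (g : C -> C) :
  (forall z, oball 0 1 z -> Ccont g z) -> g 0 <> 0 ->
  exists a rho, 0 < rho /\ Cmod a + rho < 1 /\ Cmod (g 0) / 4 <= Cmod (g a) * rho /\
    forall z, oball a rho z -> Cmod (g z) <= 2 * Cmod (g a).
Proof.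
intros Hg Hg0. apply Cmod_gt_0 in Hg0. set (A := Cmod (g 0)) in *.
assert (Hp2 : forall n, 0 < 2 ^ n) by (intros; apply pow_lt; lra).
apply NNPP. intros HN.
(* If no pair (a, rho) works, then around each point there is another one where |g| is
   more than twice as large, within a distance that is halved at each step; |g| would
   be unbounded near the limit of these points, which stays in the disc of radius 1/2. *)
destruct (complete_descent (fun n a => 2 ^ n * A <= Cmod (g a) /\ Cmod a <= / 2 - / (2 * 2 ^ n)) (/ 4) 0)
  as [l Hl].
- split; simpl; [unfold A; lra|]. rewrite Cmod_0. lra.
- intros n a [Ha1 Ha2]. specialize (Hp2 n).
  assert (Hi : 0 < / 2 ^ n) by now apply Rinv_0_lt_compat.
  assert (Hi1 : / 2 ^ n <= 1).
  { rewrite <- Rinv_1. apply Rinv_le_contravar; [lra|]. apply pow_R1_Rle; lra. }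
  replace (/ (2 * 2 ^ n)) with (/ 2 ^ n / 2) in Ha2 by (field; lra).
  apply NNPP. intros HN'. apply HN. exists a, (/ 4 * / 2 ^ n). repeat split; try lra.
  + replace (A / 4) with ((2 ^ n * A) * (/ 4 * / 2 ^ n)) by (field; lra).
    apply Rmult_le_compat_r; lra.
  + intros z Hz. apply Rnot_lt_le. intros Hlt. apply HN'. exists z. unfold oball in Hz.
    repeat split.
    * simpl. lra.
    * pose proof (Cmod_triangle (z - a) a) as T. replace (z - a + a)%C with z in T by ring.
      simpl. replace (/ (2 * (2 * 2 ^ n))) with (/ 2 ^ n / 4) by (field; lra). lra.
    * unfold Rdiv. lra.
- assert (Hl1 : Cmod l <= / 2).
  { destruct (Hl O) as (x & [_ Hx] & Hlx). simpl in *.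
    pose proof (Cmod_triangle (l - x) x) as T. replace (l - x + x)%C with l in T by ring. lra. }
  destruct (Hg l) with (eps := 1) as (d & Hd & Hw); [|lra|].
  { unfold oball. replace (l - 0)%C with l by ring. lra. }
  pose proof (Cmod_ge_0 (g l)) as Hgl.
  destruct (pow2_unbounded (/ d + (Cmod (g l) + 1) / A)) as [n Hn].
  destruct (Hl n) as (x & [Hx _] & Hlx). specialize (Hp2 n).
  assert (Hd' : 0 < / d) by now apply Rinv_0_lt_compat.
  assert (Hq : 0 < (Cmod (g l) + 1) / A) by (apply Rdiv_lt_0_compat; lra).
  rewrite Cmod_sub_sym in Hlx.
  assert (Hn1 : 1 < d * 2 ^ n).
  { apply (Rmult_lt_reg_l (/ d)); [easy|]. rewrite <- Rmult_assoc, Rinv_l by lra. lra. }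
  assert (Hn2 : Cmod (g l) + 1 < 2 ^ n * A).
  { apply Rlt_div_l; [easy|]. lra. }
  assert (Hlt : Cmod (x - l) < d).
  { eapply Rle_lt_trans; [exact Hlx|]. apply Rlt_div_l; [easy|]. lra. }
  specialize (Hw x Hlt).
  pose proof (Cmod_triangle (g x - g l) (g l)) as T. replace (g x - g l + g l)%C with (g x) in T by ring.
  lra.
Qed.

Lemma newton_covering (f df : C -> C) (a : C) (eta : R) :
  0 < eta -> df a <> 0 ->
  (forall z, cball a eta z -> is_cderive f z (df z)) ->
  (forall z, cball a eta z -> Cmod (df z - df a) <= Cmod (df a) / 2) ->
  forall w, Cmod (w - f a) <= Cmod (df a) * eta / 2 -> exists z, cball a eta z /\ f z = w.
Proof.
intros Heta Hm Hdf Hb w Hw. pose proof (proj1 (Cmod_gt_0 _) Hm) as HB.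
set (m := df a) in *. set (B := Cmod m) in *.
assert (Hp2 : forall n, 0 < 2 ^ n) by (intros; apply pow_lt; lra).
destruct (complete_descent (fun n z => Cmod (f z - w) <= B * eta / 2 / 2 ^ n /\
  Cmod (z - a) <= eta * (1 - / 2 ^ n)) (eta / 2) a) as [l Hl].
- split; simpl.
  + rewrite Cmod_sub_sym. lra.
  + replace (a - a)%C with (RtoC 0) by ring. rewrite Cmod_0. lra.
- intros n z [Hz1 Hz2]. specialize (Hp2 n).
  assert (Hi : 0 < / 2 ^ n) by now apply Rinv_0_lt_compat.
  (* A Newton step with the derivative frozen at a halves the error. *)
  exists (z - (f z - w) / m)%C.
  set (y := (z - (f z - w) / m)%C).
  assert (Hyz : Cmod (y - z) = Cmod (f z - w) / B).
  { unfold B. rewrite <- Cmod_div by easy. rewrite <- Cmod_opp. f_equal. unfold y. ring. }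
  assert (Hyz2 : Cmod (y - z) <= eta / 2 / 2 ^ n).
  { rewrite Hyz. apply Rle_div_l; [easy|].
    replace (eta / 2 / 2 ^ n * B) with (B * eta / 2 / 2 ^ n) by (field; lra). easy. }
  assert (Hya : Cmod (y - a) <= eta * (1 - / 2 ^ S n)).
  { pose proof (Cmod_sub_triangle y z a). simpl.
    replace (eta * (1 - / (2 * 2 ^ n))) with (eta * (1 - / 2 ^ n) + eta / 2 / 2 ^ n) by (field; lra). lra. }
  repeat split; [|easy|easy].
  assert (Hin : forall x n, Cmod (x - a) <= eta * (1 - / 2 ^ n) -> cball a eta x).
  { intros x k Hx. unfold cball. assert (0 < / 2 ^ k) by (apply Rinv_0_lt_compat, pow_lt; lra). nra. }
  pose proof (linear_approximation (cball a eta) f df m (B / 2) z y (cball_convex a eta) Hdf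
    (Hin _ _ Hz2) (Hin _ _ Hya) Hb) as T.
  replace (f y - f z - m * (y - z))%C with (f y - w)%C in T by (unfold y; field; easy).
  eapply Rle_trans; [exact T|]. rewrite Hyz. simpl.
  replace (B / 2 * (Cmod (f z - w) / B)) with (Cmod (f z - w) / 2) by (field; lra).
  replace (B * eta / 2 / (2 * 2 ^ n)) with (B * eta / 2 / 2 ^ n / 2) by (field; lra). lra.
- assert (Hla : cball a eta l).
  { destruct (Hl O) as (x & [_ Hx] & Hlx). simpl in *. unfold cball.
    pose proof (Cmod_sub_triangle l x a). lra. }
  exists l; split; [easy|]. apply eq_of_Cmod_small. intros eps Heps.
  destruct (Ccont_derive _ _ _ (Hdf l Hla) (eps / 2) ltac:(lra)) as (d & Hd & Hc).
  destruct (pow2_unbounded (eta / d + B * eta / eps)) as [n Hn].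
  assert (0 < eta / d) by now apply Rdiv_lt_0_compat.
  assert (0 < B * eta / eps) by (apply Rdiv_lt_0_compat; nra).
  destruct (Hl n) as (x & [Hx _] & Hlx). specialize (Hp2 n).
  assert (Hxl : Cmod (x - l) < d).
  { rewrite Cmod_sub_sym. eapply Rle_lt_trans; [exact Hlx|]. apply Rlt_div_l; [easy|].
    assert (eta / d < 2 ^ n) as Hn' by lra. apply Rlt_div_l in Hn'; lra. }
  specialize (Hc x Hxl). rewrite Cmod_sub_sym in Hc.
  pose proof (Cmod_sub_triangle (f l) (f x) w).
  assert (B * eta / 2 / 2 ^ n <= eps / 2); [|lra].
  apply Rle_div_l; [easy|]. assert (B * eta / eps < 2 ^ n) as Hn' by lra.
  apply Rlt_div_l in Hn'; lra.
Qed.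

(** The constant is [1 / 256 = 1/4 * 1/32 * 1/2]: the loss in choosing the centre, the ratio of the
    radius on which [df] varies little to [rho], and the factor in Newton's iteration. *)
Lemma bloch (f df : C -> C) :
  (forall z, oball 0 1 z -> is_cderive f z (df z)) ->
  exists w0, forall w, Cmod (w - w0) <= Cmod (df 0) / 256 -> exists z, oball 0 1 z /\ f z = w.
Proof.
intros Hdf.
destruct (Ceq_dec (df 0) 0) as [E|Hne].
{ exists (f 0). intros w Hw. rewrite E, Cmod_0 in Hw. exists 0. split; [apply oball_center; lra|].
  symmetry. apply Ceq_minus, Cmod_eq_0, Rle_antisym; [lra|apply Cmod_ge_0]. }
pose proof (derivative_differentiable_on 0 1 f df Hdf) as Hd2.
destruct (derivative_function _ df Hd2) as [ddf Hddf].
destruct (point_selection df) as (a & rho & Hrho & Har & HA & Hb); [|easy|].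
{ intros z Hz. exact (Ccont_derive _ _ _ (Hddf z Hz)). }
apply Cmod_gt_0 in Hne. set (B := Cmod (df a)) in *.
assert (HB : 0 < B) by nra.
assert (Hin : forall z, oball a rho z -> oball 0 1 z).
{ intros z Hz. unfold oball in *. pose proof (Cmod_sub_triangle z a 0).
  replace (a - 0)%C with a in * by ring. lra. }
(* Cauchy's estimate for df on discs of radius rho / 4 makes df vary by at most half of
   |df a| on the disc of radius rho / 32. *)
assert (H2 : forall z, cball a (rho / 2) z -> Cmod (ddf z) <= 16 * B / rho).
{ intros z Hz. unfold cball in Hz.
  replace (16 * B / rho) with ((4 * B) / (rho / 4)) by (field; lra).
  apply (cauchy_estimate df z); [lra| |apply Hddf, Hin; unfold oball; lra|].
  - intros x Hx. apply Hd2, Hin. unfold cball, oball in *. pose proof (Cmod_sub_triangle x z a). lra.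
  - intros x Hx. pose proof (Cmod_sub_triangle x z a).
    pose proof (Hb x ltac:(unfold oball; lra)). pose proof (Hb z ltac:(unfold oball; lra)).
    eapply Rle_trans; [apply Cmod_triangle|]. rewrite Cmod_opp. lra. }
exists (f a). intros w Hw.
destruct (newton_covering f df a (rho / 32)) with (w := w) as (z & Hz & Hfz).
- lra.
- now apply Cmod_gt_0.
- intros z Hz. apply Hdf, Hin. unfold cball, oball in *. lra.
- intros z Hz. fold B. unfold cball in Hz.
  apply Rle_trans with (16 * B / rho * Cmod (z - a)).
  + apply (mean_value_le_convex (cball a (rho / 2)) df ddf); [apply cball_convex| |exact H2| |unfold cball; lra].
    * intros x Hx. apply Hddf, Hin. unfold cball, oball in *. lra.
    * pose proof (oball_center a (rho / 2) ltac:(lra)). unfold cball, oball in *. lra.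
  + apply Rle_trans with (16 * B / rho * (rho / 32)).
    * apply Rmult_le_compat_l; [|easy]. apply Rdiv_le_0_compat; lra.
    * right. field. lra.
- fold B. lra.
- exists z. split; [|easy]. apply Hin. unfold cball, oball in *. lra.
Qed.

(** * Points where cosh is an odd integer *)

Lemma cos_sin_2kPI (k : Z) : cos (2 * IZR k * PI) = 1 /\ sin (2 * IZR k * PI) = 0.
Proof.
assert (H : forall n, cos (2 * INR n * PI) = 1 /\ sin (2 * INR n * PI) = 0).
{ intros n. replace (2 * INR n * PI) with (0 + 2 * INR n * PI) by ring.
  now rewrite cos_period, sin_period, cos_0, sin_0. }
destruct (Z.le_gt_cases 0 k) as [Hk|Hk].
- rewrite <- (Z2Nat.id k), <- INR_IZR_INZ by easy. apply H.
- destruct (H (Z.to_nat (- k))) as [H1 H2].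
  rewrite INR_IZR_INZ, Z2Nat.id, opp_IZR in H1, H2 by lia.
  replace (2 * - IZR k * PI) with (- (2 * IZR k * PI)) in * by ring.
  rewrite cos_neg in H1. rewrite sin_neg in H2. lra.
Qed.

Definition Ccosh (z : C) : C := ((Cexp z + Cexp (- z)) / 2)%C.

Lemma is_cderive_Ccosh (z : C) : is_cderive Ccosh z ((Cexp z - Cexp (- z)) / 2)%C.
Proof.
eapply is_cderive_ext; [reflexivity| |
  apply (is_cderive_mult (fun z => Cexp z + Cexp (- z))%C (fun _ => / 2)%C); [|apply is_cderive_const];
  apply is_cderive_plus; [apply is_cderive_Cexp|apply is_cderive_Cexp_opp]].
cbv beta. field.
Qed.

Lemma cosh_odd_ge (X : R) : 0 <= X ->
  exists (x : R) (j : Z), X <= x <= X + 3 /\ (exp x + exp (- x)) / 2 = IZR (2 * j + 1).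
Proof.
intros HX. set (ch := fun x => (exp x + exp (- x)) / 2).
(* From X to X + 3 cosh increases by at least 2, so its values there include an odd integer. *)
assert (Hgap : ch X + 2 <= ch (X + 3)).
{ unfold ch. replace (- (X + 3)) with (- X + - (3)) by ring. rewrite !exp_plus.
  assert (1 <= exp X) by (pose proof (exp_ineq1_le X); lra).
  assert (exp X * exp (- X) = 1) by (rewrite <- exp_plus, Rplus_opp_r; apply exp_0).
  assert (8 <= exp 3).
  { replace 3 with (1 + 1 + 1) by ring. rewrite !exp_plus.
    pose proof (exp_ineq1_le 1). nra. }
  pose proof (exp_pos (- X)). pose proof (exp_pos (- (3))). nra. }
set (j := (up ((ch X - 1) / 2))).
destruct (archimed ((ch X - 1) / 2)) as [H1 H2]. fold j in H1, H2.
assert (Hj : IZR (2 * j + 1) = 2 * IZR j + 1) by (rewrite plus_IZR, mult_IZR; reflexivity).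
destruct (IVT_gen ch X (X + 3) (IZR (2 * j + 1))) as (x & Hx & Hchx).
- intros x. apply derivable_continuous_pt. unfold ch. apply ex_derive_Reals_0. auto_derive. easy.
- rewrite Rmin_left, Rmax_right by lra. lra.
- rewrite Rmin_left, Rmax_right in Hx by lra. now exists x, j.
Qed.

(** Such points are found on the horizontal lines through the multiples of [2 PI i], where [cosh] is the
    real hyperbolic cosine. *)
Lemma cosh_odd_net (w0 : C) : exists (w : C) (j : Z),
  Cmod (w - w0) <= 11 /\ Ccosh w = RtoC (IZR (2 * j + 1)).
Proof.
destruct w0 as [X Y].
assert (HX : exists (x : R) (j : Z), Rabs (x - X) <= 3 /\ (exp x + exp (- x)) / 2 = IZR (2 * j + 1)).
{ destruct (Rle_dec 0 X) as [H|H].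
  - destruct (cosh_odd_ge X H) as (x & j & Hx & Hj). exists x, j. split; [apply Rabs_le; lra|easy].
  - destruct (cosh_odd_ge (- X) ltac:(lra)) as (x & j & Hx & Hj). exists (- x), j. split.
    + apply Rabs_le; lra.
    + rewrite Ropp_involutive, Rplus_comm. easy. }
destruct HX as (x & j & Hx & Hj).
pose proof PI_RGT_0. pose proof PI_4.
set (k := up (Y / (2 * PI))). destruct (archimed (Y / (2 * PI))) as [H1 H2]. fold k in H1, H2.
destruct (cos_sin_2kPI k) as [Hc Hs].
assert (HY : Rabs (2 * IZR k * PI - Y) <= 2 * PI).
{ set (q := Y / (2 * PI)) in *. assert (EY : Y = q * (2 * PI)) by (unfold q; field; lra).
  rewrite EY. apply Rabs_le. split; nra. }
exists (x, 2 * IZR k * PI), j. split.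
- eapply Rle_trans; [apply Cmod_le_abs|]. simpl. unfold Rminus in *.
  lra.
- rewrite <- Hj. unfold Ccosh, Cexp. simpl. rewrite cos_neg, sin_neg, Hc, Hs.
  unfold Cdiv, Cplus, Cinv, Cmult, RtoC; simpl. f_equal; field.
Qed.

Lemma Ci_PI_neq_0 : (Ci * PI)%C <> 0.
Proof.
apply Cmult_neq_0; [apply Ci_nz|]. intros E. apply RtoC_inj in E. pose proof PI_RGT_0. lra.
Qed.

Lemma Cexp_odd (j : Z) : Cexp (Ci * PI * RtoC (IZR (2 * j + 1))) = (- (1))%C.
Proof.
destruct (cos_sin_2kPI j) as [Hc Hs].
replace (Ci * PI * RtoC (IZR (2 * j + 1)))%C with ((0%R, (2 * IZR j * PI)%R) + (0%R, PI))%C.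
- rewrite Cexp_plus. unfold Cexp; simpl. rewrite exp_0, Hc, Hs, cos_PI, sin_PI.
  unfold Cmult, Copp, RtoC; simpl. f_equal; ring.
- rewrite plus_IZR, mult_IZR. unfold Ci, Cmult, Cplus, RtoC; simpl. f_equal; ring.
Qed.

(** * Landau's estimate *)

(** With [s^2 = p^2 - 1] the functions [p + s] and [p - s] are inverse to each other, so a logarithm [G] of
    [p + s] has [exp G + exp (- G) = 2 p]. *)
Lemma cosh_lift (p : C -> C) :
  differentiable_on (oball 0 1) p ->
  (forall z, oball 0 1 z -> p z <> 1 /\ p z <> (- (1))%C) ->
  exists G : C -> C, differentiable_on (oball 0 1) G /\
    forall z, oball 0 1 z -> Ccosh (G z) = p z.
Proof.
intros Hp Hp1.
assert (Hq : differentiable_on (oball 0 1) (fun z => p z * p z - 1)%C).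
{ intros z Hz. destruct (Hp z Hz) as [l Hl]. eexists.
  apply is_cderive_minus; [exact (is_cderive_mult p p z l l Hl Hl)|apply is_cderive_const]. }
assert (Hq0 : forall z, oball 0 1 z -> (p z * p z - 1)%C <> 0).
{ intros z Hz E. destruct (Hp1 z Hz) as [H1 H2].
  revert E. replace (p z * p z - 1)%C with ((p z - 1) * (p z - - (1)))%C by ring.
  apply Cmult_neq_0; now apply Cminus_eq_contra. }
assert (H0 : oball 0 1 0) by (apply oball_center; lra).
destruct (complex_log _ (Hq0 0 H0)) as (L1 & HL1 & _).
destruct (holomorphic_log 0 1 _ L1 Rlt_0_1 Hq Hq0 HL1) as (lam & _ & Hlam & Hdlam).
(* s is a holomorphic square root of p^2 - 1. *)
pose (s := fun z => Cexp (lam z / 2)).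
assert (Hs : forall z, oball 0 1 z -> (s z * s z = p z * p z - 1)%C).
{ intros z Hz. unfold s. rewrite <- Cexp_plus, <- (Hlam z Hz). f_equal. field. }
assert (Hv : differentiable_on (oball 0 1) (fun z => p z + s z)%C).
{ intros z Hz. destruct (Hp z Hz) as [l Hl]. destruct (Hdlam z Hz) as [m Hm]. eexists.
  apply is_cderive_plus; [exact Hl|]. apply (is_cderive_comp Cexp (fun z => lam z / 2)%C).
  - apply is_cderive_Cexp.
  - apply (is_cderive_mult lam (fun _ => / 2)%C); [exact Hm|apply is_cderive_const]. }
assert (Hinv : forall z, oball 0 1 z -> ((p z + s z) * (p z - s z) = 1)%C).
{ intros z Hz. transitivity (p z * p z - s z * s z)%C; [ring|]. rewrite Hs by easy. ring. }
assert (Hv0 : forall z, oball 0 1 z -> (p z + s z)%C <> 0).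
{ intros z Hz E. pose proof (Hinv z Hz) as H. rewrite E, Cmult_0_l in H.
  apply C1_nz. now symmetry. }
destruct (complex_log _ (Hv0 0 H0)) as (L2 & HL2 & _).
destruct (holomorphic_log 0 1 _ L2 Rlt_0_1 Hv Hv0 HL2) as (G & _ & HG & HdG).
exists G. split; [easy|]. intros z Hz. unfold Ccosh.
assert (E : Cexp (- G z) = (p z - s z)%C).
{ transitivity (((p z + s z) * (p z - s z)) * Cexp (- G z))%C; [rewrite Hinv by easy; ring|].
  rewrite <- HG by easy.
  transitivity ((Cexp (G z) * Cexp (- G z)) * (p z - s z))%C; [ring|].
  rewrite Cexp_opp_mult. ring. }
rewrite E, HG by easy. field.
Qed.

Lemma mul_ln_bound (x : R) : 0 < x -> x * Rabs (ln x) <= 1 + x ^ 2.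
Proof.
intros Hx. assert (Hln : forall y, 0 < y -> ln y <= y).
{ intros y Hy. pose proof (exp_ineq1_le (ln y)) as H. rewrite exp_ln in H by easy. lra. }
destruct (Rle_dec 0 (ln x)) as [H|H].
- rewrite Rabs_right by lra. pose proof (Hln x Hx). nra.
- rewrite Rabs_left by lra. rewrite <- ln_Rinv by easy.
  pose proof (Hln (/ x) (Rinv_0_lt_compat _ Hx)) as K.
  apply (Rmult_le_compat_l x) in K; [|lra]. rewrite Rinv_r in K by lra. nra.
Qed.

(** By the chain rule [f' = f * i PI * sinh G * G'], where [G'(0)] is bounded by Bloch's theorem and
    [|sinh G| <= 1 + |p|] grows only like the logarithm of [f]. *)
Lemma landau (f : C -> C) :
  differentiable_on (oball 0 1) f ->
  (forall z, oball 0 1 z -> f z <> 0 /\ f z <> 1) ->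
  exists l, is_cderive f 0 l /\ Cmod l <= 14080 * (1 + Cmod (f 0) ^ 2).
Proof.
intros Hf Hom.
assert (H0 : oball 0 1 0) by (apply oball_center; lra).
assert (Hnf : differentiable_on (oball 0 1) (fun z => - (1) * f z)%C).
{ intros z Hz. destruct (Hf z Hz) as [l Hl]. eexists. exact (is_cderive_scal _ f z l Hl). }
assert (Hnf0 : forall z, oball 0 1 z -> (- (1) * f z)%C <> 0).
{ intros z Hz. apply Cmult_neq_0; [|now apply Hom].
  intros E. apply (f_equal fst) in E. simpl in E. lra. }
destruct (complex_log _ (Hnf0 0 H0)) as (L0 & HL0 & HLre & HLim).
destruct (holomorphic_log 0 1 _ L0 Rlt_0_1 Hnf Hnf0 HL0) as (ell & Hell0 & Hell & Hdell).
pose proof Ci_PI_neq_0 as Hpi. set (c := (Ci * PI)%C) in *.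
pose (p := fun z => (/ c * ell z)%C).
assert (Hp : differentiable_on (oball 0 1) p).
{ intros z Hz. destruct (Hdell z Hz) as [l Hl]. eexists. apply is_cderive_scal, Hl. }
assert (Hpc : forall z, (c * p z = ell z)%C) by (intros z; unfold p; now field).
assert (Hodd : forall z j, oball 0 1 z -> p z <> RtoC (IZR (2 * j + 1))).
{ intros z j Hz E. destruct (Hom z Hz) as [_ H1]. apply H1.
  pose proof (Hell z Hz) as H. rewrite <- Hpc, E in H. unfold c in H. rewrite Cexp_odd in H.
  transitivity (- (1) * (- (1) * f z))%C; [ring|]. rewrite <- H. ring. }
destruct (cosh_lift p Hp) as (G & HdG & HG).
{ intros z Hz. split; [exact (Hodd z 0%Z Hz)|].
  replace (- (1))%C with (RtoC (IZR (2 * (-1) + 1))); [exact (Hodd z (-1)%Z Hz)|].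
  unfold RtoC, Copp; simpl. f_equal; ring. }
destruct (derivative_function _ G HdG) as [dG HdG'].
(* 2816 = 256 * 11: a larger derivative would put a disc of radius 11 in the range of G. *)
assert (HA : Cmod (dG 0) <= 2816).
{ apply Rnot_lt_le. intros Hlt. destruct (bloch G dG HdG') as [w0 Hw0].
  destruct (cosh_odd_net w0) as (w & j & Hw & Hj).
  destruct (Hw0 w ltac:(lra)) as (z & Hz & HGz).
  apply (Hodd z j Hz). rewrite <- HG by easy. now rewrite HGz. }
(* S is sinh (G 0), whose square is p(0)^2 - 1. *)
set (S := ((Cexp (G 0) - Cexp (- G 0)) / 2)%C).
assert (HS : (S * S = p 0 * p 0 - 1)%C).
{ rewrite <- (HG 0 H0). unfold S, Ccosh.
  transitivity (((Cexp (G 0) + Cexp (- G 0)) / 2) * ((Cexp (G 0) + Cexp (- G 0)) / 2)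
     - Cexp (G 0) * Cexp (- G 0))%C; [field|]. rewrite Cexp_opp_mult. reflexivity. }
exists (f 0 * (c * (S * dG 0)))%C. split.
- apply is_cderive_ext_loc with (f := fun z => (- (1) * Cexp (c * Ccosh (G z)))%C) (r := 1); [lra| |].
  + intros z Hz. rewrite HG, Hpc, Hell by easy. ring.
  + eapply is_cderive_ext; [reflexivity| |apply is_cderive_scal].
    2:{ apply (is_cderive_comp Cexp (fun z => c * Ccosh (G z))%C); [apply is_cderive_Cexp|].
        apply is_cderive_scal. apply (is_cderive_comp Ccosh G); [apply is_cderive_Ccosh|].
        now apply HdG'. }
    cbv beta. rewrite HG, Hpc, Hell by easy. fold S. ring.
- rewrite !Cmod_mult.
  assert (Hc : Cmod c = PI).
  { unfold c. rewrite Cmod_mult, Cmod_Ci, Cmod_R, Rabs_right; [ring|]. pose proof PI_RGT_0. lra. }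
  set (x := Cmod (f 0)).
  assert (Hx : 0 < x) by (apply Cmod_gt_0; now apply Hom).
  assert (Hell1 : Cmod (ell 0) <= Rabs (ln x) + PI).
  { rewrite Hell0. eapply Rle_trans; [apply Cmod_le_abs|]. rewrite HLre.
    rewrite Cmod_mult, Cmod_opp, Cmod_1, Rmult_1_l. fold x. lra. }
  assert (Hp0 : PI * Cmod (p 0) = Cmod (ell 0)) by (rewrite <- Hpc, Cmod_mult, Hc; reflexivity).
  assert (HS1 : Cmod S <= Cmod (p 0) + 1).
  { pose proof (f_equal Cmod HS) as E. rewrite Cmod_mult in E.
    pose proof (Cmod_triangle (p 0 * p 0) (- (1))) as T. rewrite Cmod_opp, Cmod_1, Cmod_mult in T.
    unfold Cminus in E. rewrite <- E in T.
    pose proof (Cmod_ge_0 S). pose proof (Cmod_ge_0 (p 0)). nra. }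
  rewrite Hc. pose proof PI_RGT_0. pose proof PI_4.
  assert (HPS : PI * Cmod S <= Rabs (ln x) + 2 * PI) by nra.
  pose proof (mul_ln_bound x Hx).
  assert (HxPS : x * (PI * Cmod S) <= 5 * (1 + x ^ 2)).
  { apply Rle_trans with (x * (Rabs (ln x) + 2 * PI)); [apply Rmult_le_compat_l; lra|].
    assert (x * PI <= x * 4) by (apply Rmult_le_compat_l; lra).
    pose proof (pow2_ge_0 (x - 1)). lra. }
  replace (x * (PI * (Cmod S * Cmod (dG 0)))) with (x * (PI * Cmod S) * Cmod (dG 0)) by ring.
  replace (14080 * (1 + x ^ 2)) with (5 * (1 + x ^ 2) * 2816) by ring.
  apply Rmult_le_compat; try easy; [|apply Cmod_ge_0].
  pose proof (Cmod_ge_0 S). apply Rmult_le_pos; [lra|]. apply Rmult_le_pos; lra.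
Qed.

Lemma landau_ball (f : C -> C) (a : C) (r : R) : 0 < r ->
  differentiable_on (oball a r) f ->
  (forall z, oball a r z -> f z <> 0 /\ f z <> 1) ->
  exists l, is_cderive f a l /\ Cmod l * r <= 14080 * (1 + Cmod (f a) ^ 2).
Proof.
intros Hr Hf Hom.
assert (Hin : forall z, oball 0 1 z -> oball a r (a + RtoC r * z)%C).
{ intros z Hz. unfold oball in *. replace (z - 0)%C with z in Hz by ring.
  replace (a + RtoC r * z - a)%C with (RtoC r * z)%C by ring.
  rewrite Cmod_mult, Cmod_R, Rabs_right by lra. nra. }
assert (Hr0 : RtoC r <> 0) by (intros E; apply RtoC_inj in E; lra).
assert (Haff : forall z, is_cderive (fun z => a + RtoC r * z)%C z (RtoC r)).
{ intros z. eapply is_cderive_ext; [| |apply (is_cderive_affine a (RtoC r) 0)];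
    [intros; cbv beta; ring|reflexivity]. }
destruct (landau (fun z => f (a + RtoC r * z)%C)) as (l & Hl & Hb).
- intros z Hz. destruct (Hf _ (Hin z Hz)) as [l Hl]. eexists.
  apply (is_cderive_comp f (fun z => a + RtoC r * z)%C); [exact Hl|apply Haff].
- intros z Hz. now apply Hom, Hin.
- replace (a + RtoC r * 0)%C with a in Hb by ring.
  exists (l / RtoC r)%C. split.
  + apply (is_cderive_ext (fun z => f (a + RtoC r * (/ RtoC r * (z - a))))%C f a (l * / RtoC r)%C);
      [intros x; f_equal; now field|reflexivity|].
    apply (is_cderive_comp (fun z => f (a + RtoC r * z))%C (fun z => / RtoC r * (z - a))%C).
    * replace (/ RtoC r * (a - a))%C with (RtoC 0) by ring. exact Hl.
    * eapply is_cderive_ext; [| |apply (is_cderive_affine 0 (/ RtoC r) a)];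
        [intros; cbv beta; ring|reflexivity].
  + rewrite Cmod_div, Cmod_R, Rabs_right by (easy || lra).
    replace (Cmod l / r * r) with (Cmod l) by (field; lra). exact Hb.
Qed.

(** * The bound along a segment *)

(** The modulus of [g] grows at most at the speed [|l|], by the Cauchy-Schwarz inequality. *)
Lemma is_derive_atan_Cmod (g : R -> C) (t : R) (l : C) :
  is_derive (V := C_R_NormedModule) g t l -> g t <> 0 ->
  exists d, is_derive (fun s => atan (Cmod (g s))) t d /\ Rabs d * (1 + Cmod (g t) ^ 2) <= Cmod l.
Proof.
intros Hg H0. pose proof (is_derive_fst g t l Hg) as HR. pose proof (is_derive_snd g t l Hg) as HI.
pose proof (proj1 (Cmod_gt_0 _) H0) as Hm.
set (x := fun s => fst (g s)) in *. set (y := fun s => snd (g s)) in *.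
assert (Hxy : Cmod (g t) = sqrt (x t ^ 2 + y t ^ 2)) by reflexivity.
assert (Hpos : 0 < x t ^ 2 + y t ^ 2).
{ apply sqrt_lt_0_alt. rewrite sqrt_0, <- Hxy. exact Hm. }
exists ((x t * fst l + y t * snd l) / Cmod (g t) / (1 + Cmod (g t) ^ 2)). split.
- apply (is_derive_ext (fun s => atan (sqrt (x s ^ 2 + y s ^ 2)))); [reflexivity|].
  evar_last.
  + auto_derive; [repeat split; try (eexists; eassumption); try exact Hpos|reflexivity].
  + replace (Derive (fun s => x s) t) with (fst l) by (symmetry; exact (is_derive_unique x t _ HR)).
    replace (Derive (fun s => y s) t) with (snd l) by (symmetry; exact (is_derive_unique y t _ HI)).
    rewrite !Rmult_1_r. replace (x t * x t + y t * y t) with (x t ^ 2 + y t ^ 2) by ring.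
    rewrite <- Hxy. pose proof (pow2_ge_0 (Cmod (g t))). field. lra.
- set (m := Cmod (g t)) in *.
  assert (Hd : 0 < 1 + m ^ 2) by (pose proof (pow2_ge_0 m); lra).
  unfold Rdiv at 1. rewrite Rabs_mult, (Rabs_right (/ (1 + m ^ 2))) by (left; now apply Rinv_0_lt_compat).
  rewrite Rmult_assoc, Rinv_l, Rmult_1_r by lra.
  rewrite Rabs_div by lra. rewrite (Rabs_right m) by lra. apply Rle_div_l; [easy|].
  pose proof (fst_le_Cmod (l * Cconj (g t))) as H. rewrite Cmod_mult, Cmod_conj in H. fold m in H.
  replace (fst (l * Cconj (g t))%C) with (x t * fst l + y t * snd l) in H; [exact H|].
  unfold x, y; simpl; ring.
Qed.

(* The bound is an upper bound only while the angle stays below PI/2, where it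
   increases to infinity; past PI/2 it is read as +infinity (no constraint). The
   unguarded inequality with the periodic tangent is false for every L >= 0. *)
Theorem theorem0p4 :
  exists L : R, 0 <= L /\
    forall (f : C -> C) (M : R),
      holomorphic_on unit_disc f ->
      omits_on unit_disc f (RtoC 0) ->
      omits_on unit_disc f (RtoC 1) ->
      Cmod (f (RtoC 0)) < M ->
      forall r : R, 0 < r < 1 ->
        atan M + 2 * r * L / (1 - r ^ 2) < PI / 2 ->
        forall z : C, Cmod z < r ->
          Cmod (f z) < tan (atan M + 2 * r * L / (1 - r ^ 2)).
Proof.
(* 14080 = 5 * 2816, from the estimate of Landau type. *)
exists 14080. split; [lra|].
intros f M Hhol H0 H1 HM r Hr Hlt z Hz.
assert (Hland : forall a, Cmod a <= Cmod z ->
  exists l, is_cderive f a l /\ Cmod l * (1 - r) <= 14080 * (1 + Cmod (f a) ^ 2)).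
{ intros a Ha. apply landau_ball; [lra| |].
  - intros w Hw. assert (Hw1 : unit_disc w).
    { unfold unit_disc, oball in *. pose proof (Cmod_triangle (w - a) a) as T.
      replace (w - a + a)%C with w in T by ring. lra. }
    destruct (Hhol w Hw1) as [l Hl]. exists l. now apply is_cderive_of_is_derive.
  - intros w Hw. assert (Hw1 : unit_disc w).
    { unfold unit_disc, oball in *. pose proof (Cmod_triangle (w - a) a) as T.
      replace (w - a + a)%C with w in T by ring. lra. }
    split; [now apply H0|now apply H1]. }
set (phi := fun t => atan (Cmod (f (seg 0 z t)))).
assert (Hsegz : forall t, 0 <= t <= 1 -> Cmod (seg 0 z t) <= Cmod z).
{ intros t Ht. pose proof (Cmod_seg 0 z t Ht) as T.
  replace (seg 0 z t - 0)%C with (seg 0 z t) in T by ring. replace (z - 0)%C with z in T by ring. easy. }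
set (K := 14080 * r / (1 - r)).
assert (Hphi : forall t, 0 <= t <= 1 -> is_derive phi t (Derive phi t) /\ Rabs (Derive phi t) <= K).
{ intros t Ht.
  destruct (Hland (seg 0 z t)) as (l & Hl & Hb); [apply Hsegz; lra|].
  destruct (is_derive_atan_Cmod (fun s => f (seg 0 z s)) t (l * (z - 0))%C) as (d & Hd & Hdb).
  - now apply is_derive_seg.
  - apply H0. unfold unit_disc. pose proof (Hsegz t ltac:(lra)). lra.
  - rewrite (is_derive_unique _ _ _ Hd : Derive phi t = d). split; [exact Hd|].
    rewrite Cmod_mult in Hdb. replace (z - 0)%C with z in Hdb by ring.
    set (m := 1 + Cmod (f (seg 0 z t)) ^ 2) in *.
    assert (Hm : 0 < m) by (unfold m; pose proof (pow2_ge_0 (Cmod (f (seg 0 z t)))); lra).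
    apply Rle_div_r; [lra|]. apply (Rmult_le_reg_r m); [easy|].
    pose proof (Cmod_ge_0 l). pose proof (Cmod_ge_0 z). pose proof (Rabs_pos d).
    replace (Rabs d * (1 - r) * m) with ((Rabs d * m) * (1 - r)) by ring.
    apply Rle_trans with (Cmod l * Cmod z * (1 - r)); [apply Rmult_le_compat_r; lra|].
    replace (Cmod l * Cmod z * (1 - r)) with ((Cmod l * (1 - r)) * Cmod z) by ring.
    replace (14080 * r * m) with ((14080 * m) * r) by ring.
    apply Rmult_le_compat; try lra. apply Rmult_le_pos; lra. }
destruct (MVT_gen phi 0 1 (Derive phi)) as (c & Hc & E).
{ rewrite Rmin_left, Rmax_right by lra. intros x Hx. apply Hphi. lra. }
{ rewrite Rmin_left, Rmax_right by lra. intros x Hx.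
  apply derivable_continuous_pt. eexists. apply is_derive_Reals, Hphi. lra. }
rewrite Rmin_left, Rmax_right in Hc by lra.
rewrite Rminus_0_r, Rmult_1_r in E.
unfold phi at 1 2 in E. rewrite seg_0, seg_1 in E.
destruct (Hphi c Hc) as [_ Hb]. pose proof (Rle_abs (Derive phi c)).
assert (HK : K <= 2 * r * 14080 / (1 - r ^ 2)).
{ unfold K. apply Rle_div_l; [lra|].
  replace (2 * r * 14080 / (1 - r ^ 2) * (1 - r)) with (14080 * r * (2 / (1 + r))) by (field; nra).
  rewrite <- (Rmult_1_r (14080 * r)) at 1. apply Rmult_le_compat_l; [lra|]. apply Rle_div_r; lra. }
pose proof (atan_increasing _ _ HM) as HaM.
rewrite <- (tan_atan (Cmod (f z))). pose proof (atan_bound (Cmod (f z))).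
apply tan_increasing; lra.
Qed.
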